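(* As $n\to\infty$ the affine insertion bijection $\Phi_{\mathrm{id},\mathrm{id}}$ (with $l=0$) converges to RSK row insertion. That is: for every matrix $m=(m_{ij})_{i,j>0}$ of nonnegative integers with finitely many nonzero entries there is an $N$ such that for all $n\ge N$ the matrix $m$ is $n$-bounded and, writing $\Phi_{\mathrm{id},\mathrm{id}}(m)=(P,Q)$ for the affine insertion map for $\tilde S_n$, the chains of $n$-cores associated with the strong tableau $P$ and with the weak tableau $Q$ are the chains of partitions of, respectively, the insertion tableau and the recording tableau of $m$ under the Robinson–Schensted–Knuth row insertion correspondence.
   Context: RSK convention: list the pairs $(i,j)$, each with multiplicity $m_{ij}$, in lexicographically increasing order; row insert the second entries $j$ successively to obtain the insertion tableau, and record each new box with the corresponding first entry $i$ to obtain the recording tableau. A semistandard tableau is identified with the chain of partitions $\varnothing=\lambda^{(0)}\subseteq\lambda^{(1)}\subseteq\cdots$, where $\lambda^{(j)}$ is the shape of the entries $\le j$. Affine symmetric group. For $n\ge2$, $\overline a$ denotes the class of $a\in\mathbb Z$ in $\mathbb Z/n\mathbb Z$. $\tilde S_n$ is the group under composition of bijections $w:\mathbb Z\to\mathbb Z$ with $w(i+n)=w(i)+n$ and $\sum_{i=1}^n(w(i)-i)=0$. For $\overline r\ne\overline s$, $t_{r,s}\in\tilde S_n$ exchanges $r$ and $s$ and fixes all $i$ with $\overline i\notin\{\overline r,\overline s\}$. $s_i=t_{i,i+1}$ (depends only on $\overline i$); $\ell(w)$ is the minimal number of $s_i$'s in a factorization of $w$. $w$ is Grassmannian if $w(1)<\dots<w(n)$.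 $\tilde S_n$ acts on partitions: with the residue of the cell in row $i$, column $j$ being $\overline{j-i}$, $s_i\lambda$ is obtained by removing every removable cell of residue $\overline i$ and adding every addable cell of residue $\overline i$; $w\mapsto\mathfrak c(w)=w\cdot\varnothing$ is a bijection from Grassmannian elements to $n$-cores (partitions with no removable $n$-ribbon). Strong strips and tableaux ($l=0$). $w\lessdot u$ means $\ell(u)=\ell(w)+1$ and $u=wt_{i,j}$ for some $t_{i,j}$. A marked strong cover $C=(w\xrightarrow{i,j}u)$ consists of $w,u$ and an ordered pair $(i,j)\in\mathbb Z^2$ with $w\lessdot u$, $u=wt_{i,j}$, $i\le l<j$; $\mathrm{ins}(C)=w$, $\mathrm{out}(C)=u$, $m(C)=w(j)=u(i)$. A strong strip $S$ from $w$ to $u$ is a sequence $(C_1,\dots,C_r)$, $r\ge0$, of marked strong covers forming a chain from $w$ to $u$ with $m(C_1)<\dots<m(C_r)$; $\mathrm{size}(S)=r$, $\mathrm{ins}(S)=w$, $\mathrm{out}(S)=u$. A strong tableau is a sequence $(S_1,S_2,\dots)$ of strong strips with $\mathrm{out}(S_k)=\mathrm{ins}(S_{k+1})$, almost all of size $0$. Weak strips and tableaux. For a proper cyclic interval $I=\{a,a+1,\dots,b\}\subsetneq\mathbb Z/n\mathbb Z$ let $c_I=s_b\cdots s_{a+1}s_a$; for $A\subsetneq\mathbb Z/n\mathbb Z$, $c_A$ is the product of the commuting $c_I$ over maximal cyclic intervals $I$ of $A$. A weak strip $W=(w\overset{A}{\rightsquigarrow}v)$ is given by $w,v\in\tilde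 S_n$, $A\subsetneq\mathbb Z/n\mathbb Z$ with $v=c_Aw$, $\ell(v)=\ell(w)+|A|$; size $|A|$, $\mathrm{ins}=w$, $\mathrm{out}=v$. Weak tableaux are sequences $(W_1,W_2,\dots)$ of weak strips with the same conventions. The chain of cores associated with a strong or weak tableau starting at $\mathrm{id}$ and consisting of strips $X_1,X_2,\dots$ is $\varnothing,\mathfrak c(\mathrm{out}(X_1)),\mathfrak c(\mathrm{out}(X_2)),\dots$. A matrix is $n$-bounded if it has nonnegative integer entries, finitely many nonzero, and all row sums $<n$. An initial pair is a weak strip and a strong strip with the same $\mathrm{ins}$; a final pair is a weak strip and a strong strip with the same $\mathrm{out}$. An integer $i$ is $A$-nice if $\overline{i-1}\notin A$ and $A$-bad if $\overline i\notin A$. Internal insertion at $C=(w\xrightarrow{i,j}u)$. Input: a final pair $(W,S_1')$ with $W=(w\overset{A}{\rightsquigarrow}v)$. Output: a final pair $(W',S')$ with $W'=(u\overset{A'}{\rightsquigarrow}x)$, $x=c_{A'}u$, given as follows. Case A: $v(i)<v(j)$. Then $A'=A$ and $S'$ is $S_1'$ followed by $v\xrightarrow{i,j}x$. Otherwise let $p_0=u(i)-1$, $A^\vee=A\setminus\{\overline{p_0}\}$, and if $\mathrm{size}(S_1')>0$ let the last cover of $S_1'$ be $y\xrightarrow{a_1,b_1}v$. Case B: $v(i)>v(j)$ and either $\mathrm{size}(S'_1)=0$ or $a_1\ne i$. Let $q<p$ be the pair of consecutive $A^\vee$-nice integers such that $q<u(j)$, $u^{-1}(q)\le l$ and $q$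 is maximal. Then $A'=A^\vee\cup\{\overline{p-1}\}$ and $S'$ is $S_1'$ followed by $v\xrightarrow{u^{-1}(q),u^{-1}(p)}x$. Case C: $v(i)>v(j)$, $\mathrm{size}(S_1')>0$ and $a_1=i$. Let $q<p$ be the pair of consecutive $A^\vee$-bad integers such that $q<p_0$, $y^{-1}(q)\le l$ and $q$ is maximal. Then $A'=A^\vee\cup\{\overline q\}$, and $S'$ is obtained from $S_1'$ by replacing its last cover $y\xrightarrow{i,b_1}v$ by $y\xrightarrow{y^{-1}(q),y^{-1}(p)}v'\xrightarrow{i,b_1}x$. External insertion. Input: a final pair $(W,S_1')$, $W=(w\overset{A}{\rightsquigarrow}v)$, $|A|<n-1$. Let $q<p$ be the pair of consecutive $A$-bad integers with $v^{-1}(q)\le l$ and $q$ maximal. Output $(W',S')$ with $A'=A\cup\{\overline q\}$, $W'=(w\overset{A'}{\rightsquigarrow}x)$, $x=c_{A'}w$, and $S'$ equal to $S_1'$ followed by $v\xrightarrow{v^{-1}(q),v^{-1}(p)}x$. Local rule. For an initial pair $(W,S)$ with $\mathrm{out}(W)=v$, $\mathrm{out}(S)=u$, $S=(C_1,\dots,C_r)$, and $e\ge0$ with $\mathrm{size}(W)+e<n$, $\phi_{u,v}(W,S,e)$ is the final pair obtained by starting with $(W,\text{empty strong strip at }v)$, applying internal insertion at $C_1,\dots,C_r$ successively, and then applying $e$ external insertions. Affine insertion. For an $n$-bounded matrix $m$, the growth diagram is the array $G_{ij}\in\tilde S_n$ ($i,j\ge0$), with $G_{0,j}=G_{i,0}=\mathrm{id}$,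 horizontal edges $G_{i,j-1}\to G_{i,j}$ strong strips and vertical edges $G_{i-1,j}\to G_{i,j}$ weak strips (all empty in row $0$ and column $0$), determined recursively by: for $i,j\ge1$, if $S$ is the strip $G_{i-1,j-1}\to G_{i-1,j}$ and $W$ the strip $G_{i-1,j-1}\to G_{i,j-1}$, then the weak strip $W'$ from $G_{i-1,j}$ to $G_{i,j}$ and the strong strip $S'$ from $G_{i,j-1}$ to $G_{i,j}$ are given by $(W',S')=\phi_{G_{i-1,j},G_{i,j-1}}(W,S,m_{ij})$. Then $\Phi_{\mathrm{id},\mathrm{id}}(m)=(P,Q)$, where $P$ is the strong tableau given by row $i$ of $G$ for all $i\gg0$ and $Q$ is the weak tableau given by column $j$ for all $j\gg0$. *)

(* Defs.v *)
From HB Require Import structures.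
From mathcomp Require Import all_boot all_order all_algebra finmap.

Set Implicit Arguments.
Unset Strict Implicit.
Unset Printing Implicit Defensive.

Import Order.TTheory GRing.Theory Num.Theory.

Local Open Scope ring_scope.

(* The entry m_{ij} is m (i, j); rows and columns are numbered from 1. *)
Definition matrix_pos (m : {fsfun nat * nat -> nat with 0%N}) : Prop :=
  forall i j, (i == 0%N) || (j == 0%N) -> m (i, j) = 0%N.

Definition n_bounded (n : nat) (m : {fsfun nat * nat -> nat with 0%N}) : Prop :=
  forall i, (\sum_(p <- finsupp m | p.1 == i) m p < n)%N.

Definition lex_le (p q : nat * nat) : bool :=
  (p.1 < q.1)%N || ((p.1 == q.1) && (p.2 <= q.2)%N).

Definition biword (m : {fsfun nat * nat -> nat with 0%N}) : seq (nat * nat) :=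
  flatten [seq nseq (m p) p | p <- sort lex_le (finsupp m)].

(* Tableaux are lists of rows, in English notation.  [row_insert x T] is the
   new tableau together with the (0-based) index of the row that grows. *)
Fixpoint row_insert (x : nat) (T : seq (seq nat)) : seq (seq nat) * nat :=
  match T with
  | [::] => ([:: [:: x]], 0%N)
  | r :: T' =>
      let k := find (fun y => x < y)%N r in
      if (k < size r)%N then
        let: (T'', d) := row_insert (nth 0%N r k) T' in
        (set_nth 0%N r k x :: T'', d.+1)
      else (rcons r x :: T', 0%N)
  end.

Definition record_box (i d : nat) (T : seq (seq nat)) : seq (seq nat) :=
  set_nth [::] T d (rcons (nth [::] T d) i).

Definition RSK_step (PQ : seq (seq nat) * seq (seq nat)) (p : nat * nat) :=
  let: (P', d) := row_insert p.2 PQ.1 in (P', record_box p.1 d PQ.2).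

Definition RSK (m : {fsfun nat * nat -> nat with 0%N}) :
    seq (seq nat) * seq (seq nat) :=
  foldl RSK_step ([::], [::]) (biword m).

(* Partitions are lists of positive parts.  [tableau_chain T j] is the shape of
   the entries <= j of T. *)
Definition tableau_chain (T : seq (seq nat)) (j : nat) : seq nat :=
  [seq k <- [seq count (fun x => x <= j)%N r | r <- T] | (0 < k)%N].

(* 'Z_n is Z/nZ only for n >= 2, which is assumed throughout. *)
Definition residue (n : nat) (a : int) : 'Z_n := a%:~R.

Definition affine_perm (n : nat) (w : int -> int) : Prop :=
  [/\ bijective w,
      forall i, w (i + n%:Z) = w i + n%:Z
    & \sum_(1 <= i < n.+1) (w i%:Z - i%:Z) = 0].

(* t_{r,s}, meaningful when r and s have distinct residues *)
Definition affine_transp (n : nat) (r s : int) : int -> int := fun i =>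
  if residue n i == residue n r then i + (s - r)
  else if residue n i == residue n s then i + (r - s)
  else i.

Definition simple_refl (n : nat) (i : int) : int -> int :=
  affine_transp n i (i + 1).

Definition simple_prod (n : nat) (s : seq int) : int -> int :=
  foldr (fun i f => simple_refl n i \o f) id s.

Definition has_length (n : nat) (w : int -> int) (k : nat) : Prop :=
  (exists2 s, size s = k & w = simple_prod n s) /\
  (forall s, w = simple_prod n s -> (k <= size s)%N).

Definition length_incr (n : nat) (w u : int -> int) (d : nat) : Prop :=
  exists2 k, has_length n w k & has_length n u (k + d)%N.

(* Rows are 0-based here: row r of s_i lam loses its last cell when that cell is
   removable of residue i, and gains one when the next cell is addable of
   residue i (the two cannot both happen for n >= 2). *)
Definition simple_act (n : nat) (i : int) (lam : seq nat) : seq nat :=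
  let L r := nth 0%N lam r in
  let removable r :=
    (L r.+1 < L r)%N && (residue n ((L r)%:Z - 1 - r%:Z) == residue n i) in
  let addable r :=
    ((r == 0%N) || (L r < L r.-1)%N) &&
    (residue n ((L r)%:Z - r%:Z) == residue n i) in
  [seq k <- mkseq (fun r => L r - removable r + addable r)%N (size lam).+1
     | (0 < k)%N].

(* c(w) = lam, i.e. w . empty = lam *)
Definition core_of (n : nat) (w : int -> int) (lam : seq nat) : Prop :=
  exists2 s, w = simple_prod n s & lam = foldr (simple_act n) [::] s.

(* [c] is the chain of cores of a tableau starting at id whose k-th strip,
   counted from 0, ends at [outs k]. *)
Definition core_chain (n : nat) (outs : nat -> int -> int)
    (c : nat -> seq nat) : Prop :=
  c 0%N = [::] /\ forall k, core_of n (outs k) (c k.+1).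

Definition strong_order_cover (n : nat) (w u : int -> int) : Prop :=
  length_incr n w u 1 /\
  exists r s, residue n r != residue n s /\ u = w \o affine_transp n r s.

Record strong_cover := StrongCover {
  sc_ins : int -> int; sc_i : int; sc_j : int; sc_out : int -> int }.

Definition sc_mark (C : strong_cover) : int := sc_ins C (sc_j C).

Definition is_strong_cover (n : nat) (l : int) (C : strong_cover) : Prop :=
  [/\ affine_perm n (sc_ins C) /\ affine_perm n (sc_out C),
      strong_order_cover n (sc_ins C) (sc_out C),
      residue n (sc_i C) != residue n (sc_j C),
      sc_out C = sc_ins C \o affine_transp n (sc_i C) (sc_j C)
    & sc_i C <= l < sc_j C].

Record strong_strip := StrongStrip {
  ss_ins : int -> int; ss_covers : seq strong_cover }.

Definition ss_out (S : strong_strip) : int -> int :=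
  last (ss_ins S) (map sc_out (ss_covers S)).

Fixpoint is_cover_chain (n : nat) (l : int) (w : int -> int)
    (cs : seq strong_cover) : Prop :=
  if cs is C :: cs' then
    [/\ is_strong_cover n l C, sc_ins C = w & is_cover_chain n l (sc_out C) cs']
  else True.

Definition is_strong_strip (n : nat) (l : int) (S : strong_strip) : Prop :=
  [/\ affine_perm n (ss_ins S),
      is_cover_chain n l (ss_ins S) (ss_covers S)
    & sorted <%R (map sc_mark (ss_covers S))].

(* In tableaux, the strip X_{k+1} is [T k]. *)
Definition is_strong_tableau (n : nat) (l : int) (T : nat -> strong_strip) :
    Prop :=
  [/\ forall k, is_strong_strip n l (T k),
      forall k, ss_out (T k) = ss_ins (T k.+1)
    & exists K, forall k, (K <= k)%N -> size (ss_covers (T k)) = 0%N].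

(* s_{a+k-1} ... s_{a+1} s_a *)
Definition cyc_interval (n : nat) (a : 'Z_n) (k : nat) : int -> int :=
  simple_prod n (rev [seq (a : nat)%:Z + x%:Z | x <- iota 0 k]).

(* length of the maximal run a, a+1, ... inside A, for A proper *)
Definition run_length (n : nat) (A : {set 'Z_n}) (a : 'Z_n) : nat :=
  find (fun k => a + k%:R \notin A) (iota 0 n).

(* The maximal cyclic intervals of A are indexed by their first elements. *)
Definition cyc_perm (n : nat) (A : {set 'Z_n}) : int -> int :=
  \big[(fun f g => f \o g)/id]_(a : 'Z_n | (a \in A) && (a - 1 \notin A))
    cyc_interval a (run_length A a).

Record weak_strip (n : nat) := WeakStrip {
  ws_ins : int -> int; ws_set : {set 'Z_n}; ws_out : int -> int }.

Definition is_weak_strip (n : nat) (W : weak_strip n) : Prop :=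
  [/\ affine_perm n (ws_ins W) /\ affine_perm n (ws_out W),
      ws_set W \proper [set: 'Z_n],
      ws_out W = cyc_perm (ws_set W) \o ws_ins W
    & length_incr n (ws_ins W) (ws_out W) #|ws_set W|].

Definition is_weak_tableau (n : nat) (T : nat -> weak_strip n) : Prop :=
  [/\ forall k, is_weak_strip (T k),
      forall k, ws_out (T k) = ws_ins (T k.+1)
    & exists K, forall k, (K <= k)%N -> #|ws_set (T k)| = 0%N].

Definition initial_pair (n : nat) (l : int) (W : weak_strip n)
    (S : strong_strip) : Prop :=
  [/\ is_weak_strip W, is_strong_strip n l S & ws_ins W = ss_ins S].

Definition final_pair (n : nat) (l : int) (W : weak_strip n)
    (S : strong_strip) : Prop :=
  [/\ is_weak_strip W, is_strong_strip n l S & ws_out W = ss_out S].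

Definition nice (n : nat) (A : {set 'Z_n}) (i : int) : bool :=
  residue n (i - 1) \notin A.

Definition bad (n : nat) (A : {set 'Z_n}) (i : int) : bool :=
  residue n i \notin A.

Definition consecutive (T : int -> bool) (q p : int) : Prop :=
  [/\ T q, T p, q < p & forall r, q < r < p -> ~~ T r].

Definition max_consecutive (T : int -> bool) (R : int -> Prop) (q p : int) :
    Prop :=
  [/\ consecutive T q p, R q
    & forall q' p', consecutive T q' p' -> R q' -> q' <= q].

(* w^{-1}(q) <= l, for w bijective *)
Definition preim_le (w : int -> int) (l q : int) : Prop :=
  exists2 a, w a = q & a <= l.

Definition add_cover (S : strong_strip) (C : strong_cover) : strong_strip :=
  StrongStrip (ss_ins S) (rcons (ss_covers S) C).

(* In the covers labelled (a, b) below, a = u^{-1}(q) and b = u^{-1}(p) (with y,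
   resp. v, in place of u in case C, resp. in external insertion). *)
Inductive internal_rule (n : nat) (l : int) (C : strong_cover)
    (W : weak_strip n) (S1 : strong_strip) : weak_strip n -> strong_strip -> Prop :=
  | InternalA :
      let i := sc_i C in let j := sc_j C in let u := sc_out C in
      let A := ws_set W in let v := ws_out W in
      let x := cyc_perm A \o u in
      v i < v j ->
      internal_rule l C W S1
        (WeakStrip u A x) (add_cover S1 (StrongCover v i j x))
  | InternalB q p a b :
      let i := sc_i C in let j := sc_j C in let u := sc_out C in
      let v := ws_out W in
      let p0 := u i - 1 in
      let A := ws_set W :\ residue n p0 in
      let A' := residue n (p - 1) |: A in
      let x := cyc_perm A' \o u in
      v j < v i ->
      (forall cs C1, ss_covers S1 = rcons cs C1 -> sc_i C1 <> i) ->
      max_consecutive (nice A) (fun q => q < u j /\ preim_le u l q) q p ->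
      u a = q -> u b = p ->
      internal_rule l C W S1
        (WeakStrip u A' x) (add_cover S1 (StrongCover v a b x))
  | InternalC cs C1 q p a b v' :
      let i := sc_i C in let j := sc_j C in let u := sc_out C in
      let v := ws_out W in
      let p0 := u i - 1 in
      let A := ws_set W :\ residue n p0 in
      let A' := residue n q |: A in
      let x := cyc_perm A' \o u in
      let y := sc_ins C1 in
      v j < v i ->
      ss_covers S1 = rcons cs C1 -> sc_i C1 = i ->
      max_consecutive (bad A) (fun q => q < p0 /\ preim_le y l q) q p ->
      y a = q -> y b = p ->
      internal_rule l C W S1
        (WeakStrip u A' x)
        (add_cover (add_cover (StrongStrip (ss_ins S1) cs)
                              (StrongCover y a b v'))
                   (StrongCover v' i (sc_j C1) x)).

Definition internal_insertion (n : nat) (l : int) (C : strong_cover)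
    (W : weak_strip n) (S1 : strong_strip) (W' : weak_strip n)
    (S' : strong_strip) : Prop :=
  [/\ is_strong_cover n l C /\ sc_ins C = ws_ins W,
      final_pair l W S1,
      internal_rule l C W S1 W' S'
    & final_pair l W' S'].

Definition external_insertion (n : nat) (l : int)
    (W : weak_strip n) (S1 : strong_strip) (W' : weak_strip n)
    (S' : strong_strip) : Prop :=
  [/\ final_pair l W S1, (#|ws_set W| < n.-1)%N,
      (let v := ws_out W in
       exists q p a b,
         [/\ max_consecutive (bad (ws_set W)) (preim_le v l) q p,
             v a = q, v b = p,
             W' = (let A' := residue n q |: ws_set W in
                   WeakStrip (ws_ins W) A' (cyc_perm A' \o ws_ins W))
           & S' = add_cover S1 (StrongCover v a b (ws_out W'))])
    & final_pair l W' S'].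

Fixpoint internal_insertions (n : nat) (l : int) (cs : seq strong_cover)
    (W : weak_strip n) (S : strong_strip) (W' : weak_strip n)
    (S' : strong_strip) : Prop :=
  if cs is C :: cs' then
    exists W1 S1, internal_insertion l C W S W1 S1 /\
                  internal_insertions l cs' W1 S1 W' S'
  else W' = W /\ S' = S.

Fixpoint external_insertions (n : nat) (l : int) (e : nat)
    (W : weak_strip n) (S : strong_strip) (W' : weak_strip n)
    (S' : strong_strip) : Prop :=
  if e is e'.+1 then
    exists W1 S1, external_insertion l W S W1 S1 /\
                  external_insertions l e' W1 S1 W' S'
  else W' = W /\ S' = S.

(* phi_{u,v}(W, S, e) = (W', S') *)
Definition local_rule (n : nat) (l : int) (W : weak_strip n)
    (S : strong_strip) (e : nat) (W' : weak_strip n) (S' : strong_strip) :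
    Prop :=
  [/\ initial_pair l W S, (#|ws_set W| + e < n)%N, final_pair l W' S'
    & exists W1 S1,
        internal_insertions l (ss_covers S) W (StrongStrip (ws_out W) [::]) W1 S1
        /\ external_insertions l e W1 S1 W' S'].

(* [H i j] is the strong strip G_{i,j} -> G_{i,j+1} and [V i j] the weak strip
   G_{i,j} -> G_{i+1,j}. *)
Definition is_growth_diagram (n : nat) (l : int)
    (m : {fsfun nat * nat -> nat with 0%N}) (G : nat -> nat -> int -> int)
    (H : nat -> nat -> strong_strip) (V : nat -> nat -> weak_strip n) : Prop :=
  [/\ forall k, G 0%N k = id /\ G k 0%N = id,
      forall k, H 0%N k = StrongStrip id [::] /\ V k 0%N = WeakStrip id set0 id,
      forall i j, ss_ins (H i j) = G i j /\ ss_out (H i j) = G i j.+1,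
      forall i j, ws_ins (V i j) = G i j /\ ws_out (V i j) = G i.+1 j
    & forall i j, local_rule l (V i j) (H i j) (m (i.+1, j.+1))
                               (V i j.+1) (H i.+1 j)].

(* Phi_{id,id}(m) = PQ *)
Definition affine_insertion (n : nat) (l : int)
    (m : {fsfun nat * nat -> nat with 0%N})
    (PQ : (nat -> strong_strip) * (nat -> weak_strip n)) : Prop :=
  [/\ is_strong_tableau n l PQ.1, is_weak_tableau PQ.2
    & exists G H V,
      [/\ is_growth_diagram l m G H V,
          exists K, forall i, (K <= i)%N -> forall j, PQ.1 j = H i j
        & exists K, forall j, (K <= j)%N -> forall i, PQ.2 i = V i j]].

(* Main.v *)
Require Import Defs.
From mathcomp Require Import all_boot all_order all_algebra finmap zify ring.
From Stdlib Require Import FunctionalExtensionality.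

Set Implicit Arguments.
Unset Strict Implicit.
Unset Printing Implicit Defensive.

Import Order.TTheory GRing.Theory Num.Theory.

(** All shapes that occur for a given matrix fit in a box of side [B], whatever
    [n] is. Once [n] is large compared with [B], contents of cells in the box are
    separated by their residues mod [n], and affine insertion becomes a rule on
    partitions, which turns out to be the one of row insertion.

    A partition [la] in the box is an n-core; the corresponding Grassmannian
    permutation [affine_grass la] takes the value [la k - k] at position [-k] and
    the value [c + 1 - la' c] at position [c + 1], where [la'] is the conjugate of
    [la], and is extended periodically. Adding a cell of content [r] to row [k]
    multiplies it by [s_r] on the left and by the transposition of the positions
    of the row and of the column of the cell on the right ([affine_grass_add],
    [affine_grass_transp]). This gives a word for [affine_grass la] whose action
    on the empty core is [la], and a count of inversions shows that the word is
    reduced ([has_length_grass]).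

    For partitions [ka] and [be] such that [be / ka] is a horizontal strip, there
    is a weak strip between the two permutations whose set [A] consists of the
    residues of the contents of the strip ([cyc_perm_strip]), and a strong strip
    that adds the cells of [be / ka] by increasing content, hence row by row from
    the bottom up ([is_strong_strip_strong]).

    Internal insertion at the cover adding the next cell of row [k] keeps the
    cell in row [k] if the target of the weak strip does not contain it yet, and
    moves it to row [k + 1] otherwise ([internal_step]); external insertion adds a
    cell to the first row ([external_step]). Since rows are treated from the
    bottom up, new cells are also created from the bottom up, and the last rule
    of internal insertion never applies. Counting the cells row by row, the local
    rule sends [la], [mu], [nu] and the entry [e] to the partition [rho] with
      rho_0 = max(mu_0, nu_0) + e,
      rho_{k+1} = max(mu_{k+1}, nu_{k+1}) + min(mu_k, nu_k) - la_k
    ([local_rule_rsk]).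

    On the other side, insert a weakly increasing word in a row, and let [c j] and
    [c' j] be the numbers of entries at most [j] before and after. Then
      c' (j + 1) = max(c' j, c (j + 1)) + number of letters j + 1 of the word,
    and the letter [j + 1] is bumped [min(c' j, c (j + 1)) - c j] times
    ([row_word_cnt]). Iterated over the rows of the tableau, this is the same
    recursion, so the shapes of the two growth diagrams agree ([ins_word_rsk],
    [RSK_rec_tableau]). Finally every step of affine insertion is deterministic,
    so the diagram obtained is the only one ([affine_insertion_unique]). *)

(** * Residues and periodic functions *)

Local Open Scope ring_scope.

Section Residues.
Variable n : nat.
Hypothesis n_gt1 : (1 < n)%N.

Lemma residueD x y : residue n (x + y) = residue n x + residue n y.
Proof. exact: intrD. Qed.

Lemma residueB x y : residue n (x - y) = residue n x - residue n y.
Proof. exact: intrB. Qed.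

Lemma residue1 : residue n 1 = 1.
Proof. by []. Qed.

Lemma residue_nat (k : nat) : residue n k%:Z = k%:R.
Proof. by []. Qed.

Lemma residue_val (a : 'Z_n) : residue n (a : nat)%:Z = a.
Proof. by rewrite residue_nat natr_Zp. Qed.

Lemma residue_eq0 x : (residue n x == 0) = (n %| x)%Z.
Proof.
have nat_case (k : nat) : (residue n k%:Z == 0) = (n %| k)%N.
  by rewrite residue_nat -val_eqE /= val_Zp_nat.
case: x => k; first by rewrite nat_case dvdzE.
rewrite NegzE /residue rmorphN oppr_eq0 dvdzE abszN.
exact: nat_case.
Qed.

Lemma residue_eq x y : (residue n x == residue n y) = (n %| x - y)%Z.
Proof. by rewrite -residue_eq0 residueB subr_eq0. Qed.

Lemma residue_period x : residue n (x + n%:Z) = residue n x.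
Proof. by apply/eqP; rewrite residue_eq addrAC subrr add0r dvdzz. Qed.

(** This turns comparisons of residues into comparisons of contents, as soon as
    [n] exceeds the spread of the contents that occur. *)
Lemma residue_near x y : - n%:Z < x - y < n%:Z ->
  (residue n x == residue n y) = (x == y).
Proof.
move=> near; rewrite residue_eq; apply/idP/eqP => [/dvdzP[k kE]|->].
  suff k0 : k = 0 by move: kE; rewrite k0 mul0r => /eqP; rewrite subr_eq0 => /eqP.
  nia.
by rewrite subrr dvdz0.
Qed.

Lemma residueP x y :
  reflect (exists k : int, x = y + k * n%:Z) (residue n x == residue n y).
Proof.
rewrite residue_eq; apply: (iffP dvdzP) => [[k kE]|[k ->]]; exists k.
  by rewrite -kE addrC subrK.
by rewrite addrAC subrr add0r.
Qed.

Lemma residue_add1_neq x : (residue n (x + 1) == residue n x) = false.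
Proof. by rewrite residue_near; lia. Qed.

Lemma affine_transp_period r s i :
  affine_transp n r s (i + n%:Z) = affine_transp n r s i + n%:Z.
Proof.
by rewrite /affine_transp residue_period; do 2?case: ifP => _; lia.
Qed.

Definition periodic (w : int -> int) := forall i, w (i + n%:Z) = w i + n%:Z.

Lemma periodicM w (hw : periodic w) i k : w (i + k * n%:Z) = w i + k * n%:Z.
Proof.
have pos (j : nat) x : w (x + j%:Z * n%:Z) = w x + j%:Z * n%:Z.
  elim: j x => [|j IH] x; first by rewrite !mul0r !addr0.
  by rewrite -addn1 PoszD mulrDl mul1r !addrA hw IH.
case: k => k; first exact: pos.
apply: (addIr (k.+1%:Z * n%:Z)); rewrite -pos NegzE mulNr !subrK.
by [].
Qed.

Lemma periodic_comp f g : periodic f -> periodic g -> periodic (f \o g).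
Proof. by move=> hf hg i; rewrite /= hg hf. Qed.

Lemma simple_refl_period r : periodic (simple_refl n r).
Proof. by move=> i; apply: affine_transp_period. Qed.

Lemma simple_prod_period s : periodic (simple_prod n s).
Proof.
by elim: s => [//|r s IH]; apply: periodic_comp; first exact: simple_refl_period.
Qed.

(** Identities between affine permutations can thus be checked in a window
    where nothing wraps around. *)
Lemma eq_periodic (B : int) f g : periodic f -> periodic g ->
  (forall z : int, - B <= z < n%:Z - B -> f z = g z) -> f = g.
Proof.
move=> hf hg fg; apply: functional_extensionality => z.
have -> : z = ((z + B)%R %% n)%Z - B + ((z + B)%R %/ n)%Z * n%:Z.
  by have := divz_eq (z + B) n%:Z; lia.
rewrite !periodicM // fg //.
by lia.
Qed.

Lemma simple_reflE r z :
  simple_refl n r z = if residue n z == residue n r then z + 1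
    else if residue n z == residue n (r + 1) then z - 1 else z.
Proof.
rewrite /simple_refl /affine_transp.
by do 2?case: ifP => // _; lia.
Qed.

Lemma simple_reflK r : involutive (simple_refl n r).
Proof.
move=> z; rewrite !simple_reflE.
have r1 y : residue n (y + 1) = residue n y + 1 by rewrite residueD.
have r1' y : residue n (y - 1) = residue n y - 1 by rewrite residueB.
case: (residue n z =P residue n r) => hz.
  have -> : residue n (z + 1) = residue n (r + 1) by rewrite !r1 hz.
  by rewrite residue_add1_neq eqxx addrK.
case: (residue n z =P residue n (r + 1)) => hz1; last by rewrite (introF eqP hz) (introF eqP hz1).
by rewrite r1' hz1 r1 addrK eqxx subrK.
Qed.

Lemma periodic_residue w x y : periodic w ->
  residue n x = residue n y -> residue n (w x) = residue n (w y).
Proof.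
move=> hw /eqP/residueP[k ->]; apply/eqP/residueP; exists k.
by rewrite periodicM.
Qed.

Lemma simple_refl_ne r x y : residue n x != residue n y ->
  residue n (simple_refl n r x) != residue n (simple_refl n r y).
Proof.
apply: contra_neq => /(periodic_residue (@simple_refl_period r)).
by rewrite !simple_reflK.
Qed.

Lemma simple_prod_ne s x y : residue n x != residue n y ->
  residue n (simple_prod n s x) != residue n (simple_prod n s y).
Proof. by move=> xy; elim: s => [//|r s IH]; apply: simple_refl_ne. Qed.

End Residues.

(** * Cyclically decreasing products *)

Lemma comp_big_fix (I : Type) (X : Type) (r : seq I) (P : pred I) (F : I -> X -> X) x :
  (forall a, P a -> F a x = x) -> (\big[(fun f g => f \o g)/id]_(a <- r | P a) F a) x = x.
Proof. by move=> fix_x; elim/big_rec: _ => //= a f Pa fx; rewrite fx fix_x. Qed.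

(** When a single factor moves [x], and the image is not moved again, the order
    of the factors does not matter. *)
Lemma comp_big_one (I : eqType) (X : Type) (r : seq I) (P : pred I) (F : I -> X -> X) a x :
  uniq r -> a \in r -> P a ->
  (forall b, P b -> b != a -> F b x = x /\ F b (F a x) = F a x) ->
  (\big[(fun f g => f \o g)/id]_(b <- r | P b) F b) x = F a x.
Proof.
move=> + + Pa fixed; elim: r => // b r IH /= /andP[br ur].
rewrite inE big_cons; case: (eqVneq a b) => [ab _|ab /= ar].
  subst b; rewrite Pa /= big_seq_cond comp_big_fix // => c /andP[cr Pc].
  by case: (fixed c Pc) => //; apply: contraNneq br => <-.
case: ifP => Pb; last exact: IH.
by rewrite /= IH //; case: (fixed b Pb) => //; rewrite eq_sym.
Qed.

Section CyclicProducts.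
Variable n : nat.
Hypothesis n_gt1 : (1 < n)%N.
Implicit Types (A : {set 'Z_n}) (a : 'Z_n).

(** The factor of an interval is a cycle: the reflections are applied from the
    lowest one up, carrying the first class along. *)
Lemma cyc_intervalE a (k i : nat) y : (k < n)%N -> (i < n)%N ->
  residue n y = a + i%:R ->
  cyc_interval a k y = if i == 0%N then y + k%:Z else if (i <= k)%N then y - 1 else y.
Proof.
move=> kn ilt yE; rewrite /cyc_interval.
elim: k kn => [|k IH] kn; first by case: i ilt yE => [|i] ilt yE /=; rewrite ?addr0.
rewrite -(addn1 k) iotaD map_cat rev_cat /= IH; last by lia.
have yr : residue n (a%:Z + i%:Z) = residue n y by rewrite residueD residue_val residue_nat yE.
move/eqP: yr; rewrite eq_sym => /residueP-/(_ n_gt1)[c ->].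
have cr z : residue n (z + c * n%:Z) = residue n z.
  by apply/eqP/residueP => //; exists c.
rewrite simple_reflE //.
case: (i =P 0%N) => [->|i0].
  have -> : a%:Z + 0%:Z + c * n%:Z + k%:Z = a%:Z + (0%N + k)%:Z + c * n%:Z by lia.
  by rewrite cr add0n eqxx; lia.
case: (ltngtP i k.+1) => ik.
- have -> : (i <= k)%N by lia.
  have -> : (i <= k + 1)%N by lia.
  rewrite (_ : _ + _ - 1 = a%:Z + i%:Z - 1 + c * n%:Z); last by lia.
  rewrite cr !residue_near //; try lia.
  by rewrite !ifF; lia.
- have -> : (i <= k)%N = false by lia.
  have -> : (i <= k + 1)%N = false by lia.
  rewrite cr !residue_near //; try lia.
  by rewrite !ifF; lia.
have -> : (i <= k)%N = false by lia.
have -> : (i <= k + 1)%N by lia.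
rewrite cr !residue_near //; try lia.
by rewrite ifF; [rewrite ifT|]; lia.
Qed.

Lemma ZnE a b : exists2 i, (i < n)%N & a = b + i%:R.
Proof.
exists (nat_of_ord (a - b)); last by rewrite natr_Zp addrC subrK.
by have := ltn_ord (a - b); rewrite {2}Zp_cast.
Qed.

Lemma natn0 : n%:R = 0 :> 'Z_n.
Proof. by apply/val_inj; rewrite /= val_Zp_nat // modnn. Qed.

Lemma natn1 : n.-1%:R = -1 :> 'Z_n.
Proof. by apply/(addIr 1); rewrite addNr natr1 prednK ?natn0 //; lia. Qed.

Lemma run_lengthP A a : a - 1 \notin A ->
  [/\ (run_length A a < n)%N, forall i, (i < run_length A a)%N -> a + i%:R \in A
    & a + (run_length A a)%:R \notin A].
Proof.
move=> aA; have hasA : has (fun k => a + k%:R \notin A) (iota 0 n).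
  by apply/hasP; exists n.-1; rewrite ?natn1 // mem_iota; lia.
have lt : (run_length A a < n)%N by rewrite -{2}(size_iota 0 n) -has_find.
split=> // [i ilt|].
  apply: negbNE; have := before_find 0%N ilt; rewrite nth_iota ?add0n => [->//|].
  exact: ltn_trans lt.
by have := nth_find 0%N hasA; rewrite nth_iota ?add0n.
Qed.

Definition run_start A a := (a \in A) && (a - 1 \notin A).

(** The class preceding the start of an interval is not in [A], so the classes
    moved by the factors of distinct maximal intervals are distinct. *)
Lemma run_disjoint A a b i j : run_start A a -> run_start A b ->
  (i <= run_length A a)%N -> (j <= run_length A b)%N -> a + i%:R = b + j%:R -> a = b.
Proof.
wlog ij : a b i j / (i <= j)%N => [hw sa sb ia jb ab|].
  case: (leqP i j) => ij; first exact: (hw a b i j).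
  by apply/esym; apply: (hw b a j i) => //; exact: ltnW.
move=> /andP[_ a1] /andP[_ b1] ia jb ab.
have aE : a = b + (j - i)%:R by apply: (addIr i%:R); rewrite -addrA -natrD subnK.
case: (posnP (j - i)) => [ji|ji]; first by rewrite aE ji addr0.
have [_ inA _] := run_lengthP b1.
have := inA (j - i).-1; rewrite -{1}(prednK ji).
move: a1; rewrite aE -(prednK ji) -natr1 addrA addrK => /negP na h.
by case: na; apply: h; lia.
Qed.

Lemma cyc_perm_factor A a b i y : run_start A a -> run_start A b -> b != a ->
  (i <= run_length A a)%N -> residue n y = a + i%:R ->
  cyc_interval b (run_length A b) y = y.
Proof.
move=> sa sb ba ia yE; have [j jn yj] := ZnE (residue n y) b.
have [bn _ _] := run_lengthP (proj2 (andP sb)).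
rewrite (cyc_intervalE bn jn yj).
case: (leqP j (run_length A b)) => jb.
  by case/eqP: ba; apply: (run_disjoint sb sa jb ia); rewrite -yj.
by rewrite ifF //; lia.
Qed.

Lemma cyc_perm_start A a i y : run_start A a -> (i <= run_length A a)%N ->
  residue n y = a + i%:R ->
  cyc_perm A y = if i == 0%N then y + (run_length A a)%:Z else y - 1.
Proof.
move=> sa ia yE.
have [an _ _] := run_lengthP (proj2 (andP sa)).
have val : cyc_interval a (run_length A a) y =
    if i == 0%N then y + (run_length A a)%:Z else y - 1.
  by rewrite (cyc_intervalE an _ yE) ?ia //; exact: leq_ltn_trans an.
rewrite /cyc_perm (comp_big_one (a := a)) //; [exact: index_enum_uniq|by rewrite mem_index_enum|].
move=> b sb ba; split; first exact: (cyc_perm_factor sa sb ba ia yE).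
rewrite val; case: eqP => i0.
  apply: (cyc_perm_factor sa sb ba (leqnn _)).
  by rewrite residueD residue_nat yE i0 addr0.
apply: (@cyc_perm_factor _ _ _ i.-1 _ sa sb ba); first by lia.
by rewrite residueB yE residue1 -(prednK (n := i)) -1?natr1 ?addrA ?addrK //; lia.
Qed.

(** Going down from [x - 1] one leaves [A] because [A] is proper; the last class
    met in [A] starts the maximal interval whose factor moves [x], and that
    factor carries each of its integers but the first one step down. *)
Lemma cyc_perm_pred A x : A \proper setT -> residue n (x - 1) \in A ->
  cyc_perm A x = x - 1.
Proof.
case/properP=> _ [c _ cA] xA.
pose T k := residue n (x - 1) - k%:R \notin A.
have exT : exists k, T k.
  have [k _ kE] := ZnE (residue n (x - 1)) c.
  by exists k; rewrite /T kE addrK.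
case: (ex_minnP exT) => k Tk kmin.
have k0 : (0 < k)%N by case: k Tk {kmin} => //; rewrite /T subr0 xA.
have below i : (i < k)%N -> residue n (x - 1) - i%:R \in A.
  by move=> ik; apply: negbNE; apply/negP => /kmin; lia.
set a := residue n x - k%:R.
have predE : residue n (x - 1) = residue n x - 1 by rewrite residueB.
have kpred : k%:R = k.-1%:R + 1 :> 'Z_n by rewrite natr1 prednK.
have aA : a \in A by move: (below k.-1); rewrite predE /a kpred opprD (addrC (- _)) addrA; apply; lia.
have a1A : a - 1 \notin A by move: Tk; rewrite /T predE addrAC.
have [an ain aout] := run_lengthP a1A.
have ka : (k <= run_length A a)%N.
  rewrite leqNgt; apply/negP => lt; case/negP: aout.
  have := below (k - run_length A a).-1; set d := run_length A a => h.
  have <- : residue n (x - 1) - (k - d).-1%:R = a + d%:R.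
    have -> : a = residue n x - ((k - d).-1%:R + 1 + d%:R).
      by rewrite natr1 -natrD /a; congr (_ - _%:R); lia.
    by rewrite predE; ring.
  by apply: h; lia.
rewrite (cyc_perm_start (a := a) (i := k)) ?/run_start ?aA //; first by rewrite ifF //; lia.
by rewrite /a subrK.
Qed.

(** Either [x] starts a maximal interval, of length [t], whose factor carries it
    past the end of the interval, or [t = 0] and no factor moves [x]. *)
Lemma cyc_perm_run A x t : residue n (x - 1) \notin A ->
  (forall i, (i < t)%N -> residue n (x + i%:Z) \in A) ->
  residue n (x + t%:Z) \notin A -> cyc_perm A x = x + t%:Z.
Proof.
move=> x1 inA xt.
have tn : (t < n)%N.
  rewrite ltnNge; apply/negP => nt; case/negP: x1.
  have := inA n.-1; rewrite residueD residue_nat natn1 residueB residue1; apply; lia.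
case: (posnP t) => [t0|t0].
  move: xt; rewrite t0 addr0 => xA.
  apply: comp_big_fix => a sa; have [an ain aout] := run_lengthP (proj2 (andP sa)).
  have [i ilt xE] := ZnE (residue n x) a.
  rewrite (cyc_intervalE an ilt xE).
  case: eqP => [i0|i0]; first by move: xA; rewrite xE i0 addr0 (proj1 (andP sa)).
  case: leqP => // ia; case/negP: x1.
  rewrite residueB residue1 xE -(prednK (n := i)) -1?natr1 ?addrA ?addrK; last by lia.
  by apply: ain; lia.
have xA : residue n x \in A by have := inA 0%N t0; rewrite addr0.
have x1A : residue n x - 1 \notin A by rewrite -residue1 -residueB.
have start : run_start A (residue n x) by rewrite /run_start xA.
rewrite (cyc_perm_start (i := 0) start) ?addr0 //=; congr (_ + Posz _).
have [an ain aout] := run_lengthP x1A.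
case: (ltngtP (run_length A (residue n x)) t) => // lt.
  by case/negP: aout; have := inA _ lt; rewrite residueD residue_nat.
by case/negP: xt; rewrite residueD residue_nat ain.
Qed.

End CyclicProducts.

(** * Partitions in a box *)

Section Partitions.
Variable B : nat.
Implicit Types (la : nat -> nat) (k c : nat).

(** Partitions as functions of the 0-based row index, with at most [B] rows and
    columns. *)
Definition boxed la :=
  [/\ forall k, (la k.+1 <= la k)%N, (la 0 <= B)%N & la B = 0%N].

Definition add_box k la : nat -> nat := fun r => (la r + (r == k))%N.

Lemma boxed_le la j k : boxed la -> (j <= k)%N -> (la k <= la j)%N.
Proof.
case=> dec _ _; elim: k => [|k IH]; first by rewrite leqn0 => /eqP->.
by rewrite leq_eqVlt => /predU1P[->//|/IH]; apply: leq_trans.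
Qed.

Lemma boxed_leB la k : boxed la -> (la k <= B)%N.
Proof. by move=> bx; apply: leq_trans (boxed_le bx (leq0n k)) _; case: bx. Qed.

Lemma boxed_eq0 la k : boxed la -> (B <= k)%N -> la k = 0%N.
Proof.
by move=> bx /(boxed_le bx); case: bx => _ _ ->; rewrite leqn0 => /eqP.
Qed.

Definition addable k la := (k == 0%N) || (la k < la k.-1)%N.

Lemma boxed_addable la k : boxed (add_box k la) -> boxed la -> addable k la.
Proof.
move=> [dec _ _] _; rewrite /addable; case: k dec => //= k dec.
by have := dec k; rewrite /add_box eqxx; case: eqP; lia.
Qed.

Lemma boxed_add_lt la k : boxed la -> boxed (add_box k la) -> (k < B)%N /\ (la k < B)%N.
Proof.
move=> bx bx'; split.
  rewrite ltnNge; apply/negP => /(boxed_eq0 bx').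
  by rewrite /add_box eqxx addn1.
by have := boxed_leB k bx'; rewrite /add_box eqxx addn1.
Qed.

Lemma boxed_add la k : boxed la -> addable k la -> (k < B)%N -> (la k < B)%N ->
  boxed (add_box k la).
Proof.
move=> bx ad kB laB; case: (bx) => dec la0 laB0; split.
- move=> r; have := dec r; rewrite /add_box; case: eqP => [rk|_]; last by lia.
  by move: ad; rewrite /addable -rk /=; lia.
- rewrite /add_box; case: eqP => [k0|_]; last by lia.
  by move: laB; rewrite -k0; lia.
- by rewrite /add_box laB0; case: eqP => //; lia.
Qed.

(** The length of column [c], as the index of the first row not reaching it. *)
Definition conj la c := find (fun k => la k <= c)%N (iota 0 B).

Lemma conj_leB la c : (conj la c <= B)%N.
Proof. by rewrite /conj -{2}(size_iota 0 B) find_size. Qed.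

Lemma conj_spec la c : boxed la -> (la (conj la c) <= c)%N.
Proof.
move=> bx; case: (ltnP (conj la c) B) => lt; last by rewrite (boxed_eq0 bx).
have : has (fun k => la k <= c)%N (iota 0 B) by rewrite has_find size_iota.
by move/(nth_find 0%N); rewrite nth_iota ?add0n.
Qed.

Lemma lt_conj la c k : boxed la -> (k < conj la c)%N = (c < la k)%N.
Proof.
move=> bx; apply/idP/idP => [lt|].
  have := before_find 0%N lt; rewrite nth_iota ?add0n; first by lia.
  by have := conj_leB la c; lia.
apply: contraLR; rewrite -!leqNgt => /(boxed_le bx) le.
exact: leq_trans le (conj_spec c bx).
Qed.

Lemma conj_eq la c t : boxed la -> (la t <= c)%N -> (t = 0%N \/ (c < la t.-1)%N) ->
  conj la c = t.
Proof.
move=> bx lat tpos; have := lt_conj c t bx; have := lt_conj c t.-1 bx.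
by case: tpos => [t0|lt]; lia.
Qed.

Lemma conj_addable la k : boxed la -> addable k la -> conj la (la k) = k.
Proof.
by move=> bx ad; apply: conj_eq => //; case/orP: ad => [/eqP|]; [left|right].
Qed.

Lemma conj_add_box la k c : boxed la -> boxed (add_box k la) ->
  conj (add_box k la) c = (conj la c + (c == la k))%N.
Proof.
move=> bx bx'; have ad := boxed_addable bx' bx.
have ck := conj_addable bx ad.
have ltc := lt_conj c _ bx; have sp := conj_spec c bx.
have [dec _ _] := bx.
case: (c =P la k) => [cE|cE]; apply: conj_eq => //.
- rewrite cE ck addn1 /add_box; have := dec k.
  by case: eqP; lia.
- by right; rewrite cE ck addn1 /= /add_box eqxx; lia.
- by rewrite addn0 /add_box; case: eqP => [h|]; rewrite ?h in sp *; lia.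
rewrite addn0; case: (posnP (conj la c)) => [|pos]; [by left|right].
by have := ltc (conj la c).-1; rewrite /add_box; lia.
Qed.

Definition weight la := (\sum_(k < B) la k)%N.

Lemma weight_add la k : (k < B)%N -> weight (add_box k la) = (weight la).+1.
Proof.
move=> kB; rewrite /weight big_split /= -addn1; congr addn.
rewrite (bigD1 (Ordinal kB)) //= eqxx big1 ?addn0 // => i.
by rewrite -val_eqE /= => /negbTE->.
Qed.

Lemma weight_le la : boxed la -> (weight la <= B * B)%N.
Proof.
move=> bx; rewrite -[X in (_ <= X * _)%N](card_ord B) -sum_nat_const.
by apply: leq_sum => i _; exact: boxed_leB.
Qed.

(** The last cell of the lowest nonempty row can always be removed. *)
Lemma boxed_ind (P : (nat -> nat) -> Prop) : P (fun _ => 0%N) ->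
  (forall la k, boxed la -> boxed (add_box k la) -> P la -> P (add_box k la)) ->
  forall la, boxed la -> P la.
Proof.
move=> P0 Padd la; move eqw: (weight la) => w.
elim: w la eqw => [|w IH] la wE bx.
  suff -> : la = fun _ => 0%N by [].
  apply: functional_extensionality => k.
  case: (leqP B k) => kB; first exact: boxed_eq0.
  by move/eqP: wE; rewrite sum_nat_eq0 => /forallP/(_ (Ordinal kB))/eqP.
have pos : (0 < conj la 0)%N.
  rewrite lt_conj // lt0n; apply/eqP => la0; move: wE.
  by rewrite /weight big1 // => i _; have := boxed_le bx (leq0n i); lia.
set k := (conj la 0).-1.
have lak : (0 < la k)%N by rewrite -lt_conj // /k; lia.
have lak1 : la k.+1 = 0%N by have := conj_spec 0 bx; rewrite /k prednK //; lia.
have kB : (k < B)%N by have := conj_leB la 0; rewrite /k; lia.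
pose la' r := (la r - (r == k))%N.
have laE : la = add_box k la'.
  apply: functional_extensionality => r; rewrite /add_box /la'.
  by case: eqP => [->|_]; lia.
have bx' : boxed la'.
  case: (bx) => dec la0 laB; split; rewrite /la' ?laB //; last by lia.
  by move=> r; have := dec r; case: (r =P k) => [->|_]; rewrite ?lak1; lia.
rewrite laE; apply: Padd; rewrite -?laE //; apply: IH => //.
by apply/succn_inj; rewrite -wE laE weight_add // -laE.
Qed.

Definition shape la := [seq x <- mkseq la B | (0 < x)%N].

Lemma shape0 : shape (fun _ => 0%N) = [::].
Proof. by rewrite /shape /mkseq; elim: (iota _ _). Qed.

Lemma filter_mkseq (f : nat -> nat) N M : (forall r, (N <= r)%N -> f r = 0%N) ->
  (N <= M)%N -> [seq x <- mkseq f M | (0 < x)%N] = [seq x <- mkseq f N | (0 < x)%N].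
Proof.
move=> f0 NM; rewrite -(subnKC NM) /mkseq iotaD map_cat filter_cat.
rewrite [X in _ ++ X](_ : _ = [::]) ?cats0 //.
apply/eqP; rewrite -size_eq0 size_filter -leqn0 leqNgt -has_count.
apply/hasPn => x /mapP[r]; rewrite mem_iota => /andP[/f0 h _] ->.
by rewrite h.
Qed.

Lemma shapeE la : boxed la -> shape la = mkseq la (conj la 0).
Proof.
move=> bx; rewrite /shape (filter_mkseq (N := conj la 0)) ?conj_leB //; last first.
  by move=> r; rewrite leqNgt lt_conj //; lia.
apply/all_filterP/allP => x /mapP[r]; rewrite mem_iota /= => rc ->.
by rewrite -lt_conj.
Qed.

Lemma nth_shape la r : boxed la -> nth 0%N (shape la) r = la r.
Proof.
move=> bx; rewrite shapeE //; case: (ltnP r (conj la 0)) => rc.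
  by rewrite nth_mkseq.
by rewrite nth_default ?size_mkseq //; move: rc; rewrite leqNgt lt_conj //; lia.
Qed.

End Partitions.

(** * Affine Grassmannian permutations of small partitions *)

Section GrassmannianValues.
Variable B : nat.
Implicit Types (la : nat -> nat) (k c : nat).

(** Row [k] of [la] gives the value at position [-k], column [c] the value at
    position [c + 1]. *)
Definition grass la (z : int) : int :=
  if z <= 0 then (la `|z|%N)%:Z + z else z - (conj B la `|z|%N.-1)%:Z.

Lemma grass_row la k : grass la (- k%:Z) = (la k)%:Z - k%:Z.
Proof. by rewrite /grass ifT ?abszN //; lia. Qed.

Lemma grass_col la c : grass la (c%:Z + 1) = c%:Z + 1 - (conj B la c)%:Z.
Proof. by rewrite /grass ifF; [congr (_ - Posz (conj _ _ _))|]; lia. Qed.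

Lemma int_case (z : int) : (exists k, z = - k%:Z) \/ (exists c, z = c%:Z + 1).
Proof. by case: (leP z 0) => z0; [left; exists `|z|%N|right; exists `|z|%N.-1]; lia. Qed.

(** Adding a cell to row [k] exchanges the values [la k - k] and [la k - k + 1];
    this lemma and the next one find the positions that take them. *)
Lemma grass_eq_row la k z : boxed B la ->
  (grass la z == (la k)%:Z - k%:Z) = (z == - k%:Z).
Proof.
move=> bx; case: (int_case z) => -[j ->].
  rewrite grass_row; case: (ltngtP j k) => jk; last by rewrite jk !eqxx.
    by have := boxed_le bx (ltnW jk); lia.
  by have := boxed_le bx (ltnW jk); lia.
rewrite grass_col; have := lt_conj j k bx; have := conj_spec j bx.
case: (ltnP k (conj B la j)) => h; first by lia.
by have := boxed_le bx h; lia.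
Qed.

Lemma grass_eq_col la k z : boxed B la -> addable k la ->
  (grass la z == (la k)%:Z - k%:Z + 1) = (z == (la k)%:Z + 1).
Proof.
move=> bx ad; case: (int_case z) => -[j ->].
  rewrite grass_row; case: (ltngtP j k) => jk; last by rewrite jk; lia.
    have : (j <= k.-1)%N by lia.
    by move/(boxed_le bx); move: ad; rewrite /addable; lia.
  by have := boxed_le bx (ltnW jk); lia.
rewrite grass_col; have := lt_conj j k bx; have := conj_spec j bx.
have := conj_addable bx ad.
case: (j =P la k) => [->|jk cE]; first by lia.
case: (ltnP k (conj B la j)) => h; first by lia.
by have := boxed_le bx h; lia.
Qed.

Lemma grass_add la k z : boxed B la -> boxed B (add_box k la) ->
  grass (add_box k la) z =
    if z == - k%:Z then (la k)%:Z - k%:Z + 1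
    else if z == (la k)%:Z + 1 then (la k)%:Z - k%:Z else grass la z.
Proof.
move=> bx bx'; have ad := boxed_addable bx' bx; case: (int_case z) => -[j ->].
  rewrite !grass_row /add_box; case: (j =P k) => [->|jk].
    by rewrite eqxx; lia.
  by rewrite !ifF; lia.
rewrite !grass_col conj_add_box //.
rewrite ifF; last by lia.
case: (j =P la k) => [->|jk]; first by rewrite eqxx conj_addable //; lia.
by rewrite ifF; lia.
Qed.

End GrassmannianValues.

Section Grassmannian.
Variables (B n : nat).
Hypothesis n_big : (2 * B + 3 <= n)%N.
Implicit Types (la : nat -> nat) (k c : nat).

Let n_gt1 : (1 < n)%N. Proof. by lia. Qed.

(** The affine Grassmannian permutation of [la]: the periodic extension of
    [grass B la] from a window of [n] consecutive integers outside of whose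
    middle part [grass B la] is the identity. *)
Definition affine_grass la (z : int) : int :=
  let q := ((z + B.+1%:Z)%R %/ n)%Z in grass B la (z - q * n%:Z) + q * n%:Z.

Definition window (z : int) := - (B.+1)%:Z <= z < n%:Z - B.+1%:Z.

Lemma affine_grassE la z : window z -> affine_grass la z = grass B la z.
Proof.
move=> win; rewrite /affine_grass.
have -> : ((z + B.+1%:Z)%R %/ n)%Z = 0 by apply: divz_small; move: win; rewrite /window; lia.
by rewrite mul0r subr0 addr0.
Qed.

Lemma affine_grass_period la : periodic n (affine_grass la).
Proof.
move=> z; rewrite /affine_grass.
have -> : ((z + n%:Z + B.+1%:Z)%R %/ n)%Z = ((z + B.+1%:Z)%R %/ n)%Z + 1.
  have -> : z + n%:Z + B.+1%:Z = 1 * n%:Z + (z + B.+1%:Z) by lia.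
  rewrite divzMDl; last by lia.
  exact: addrC.
set q := (_ %/ _)%Z; rewrite mulrDl mul1r addrA; congr (grass B la _ + _ + _); lia.
Qed.

Lemma eq_window f g : periodic n f -> periodic n g ->
  (forall z, window z -> f z = g z) -> f = g.
Proof. by move=> hf hg fg; exact: (eq_periodic n_gt1 hf hg fg). Qed.

Lemma window_residue x : exists2 y, window y & residue n y = residue n x.
Proof.
exists (((x + B.+1%:Z)%R %% n)%Z - B.+1%:Z); first by rewrite /window; lia.
apply/eqP/residueP => //; exists (- ((x + B.+1%:Z)%R %/ n)%Z); lia.
Qed.

Lemma grass_window la z : boxed B la -> window z -> window (grass B la z).
Proof.
rewrite /window => bx; case: (int_case z) => -[k ->].
  by rewrite grass_row; have := boxed_leB k bx; lia.
by rewrite grass_col; have := conj_leB B la k; lia.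
Qed.

Lemma window_near x y : window x -> window y -> - n%:Z < x - y < n%:Z.
Proof. by rewrite /window; lia. Qed.

(** A cell of content [r] is added by [s_r] on the left, and on the right by the
    transposition of the positions of its row and of its column. *)
Lemma affine_grass_add la k : boxed B la -> boxed B (add_box k la) ->
  affine_grass (add_box k la) = simple_refl n ((la k)%:Z - k%:Z) \o affine_grass la.
Proof.
move=> bx bx'; have ad := boxed_addable bx' bx.
have [kB laB] := boxed_add_lt bx bx'.
apply: eq_window => [||z wz]; first exact: affine_grass_period.
  by apply: periodic_comp; [exact: simple_refl_period | exact: affine_grass_period].
have gz := grass_window bx wz.
rewrite /= !affine_grassE // grass_add // simple_reflE //.
rewrite !residue_near ?grass_eq_row ?grass_eq_col //; last first.
- by apply: window_near => //; rewrite /window; lia.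
- by apply: window_near => //; rewrite /window; lia.
have := grass_eq_row k z bx; have := grass_eq_col z bx ad.
case: (z =P - k%:Z) => [_ _ /eqP->//|_].
by case: (z =P (la k)%:Z + 1) => // _ /eqP-> _; lia.
Qed.

Lemma affine_transpE r s z : window r -> window s -> window z ->
  affine_transp n r s z = if z == r then s else if z == s then r else z.
Proof.
move=> wr ws wz; rewrite /affine_transp !residue_near ?window_near //.
by case: eqP => [->|_]; [|case: eqP => [->|_] //]; lia.
Qed.

Lemma affine_grass_transp la k : boxed B la -> boxed B (add_box k la) ->
  affine_grass (add_box k la) =
  affine_grass la \o affine_transp n (- k%:Z) ((la k)%:Z + 1).
Proof.
move=> bx bx'; have ad := boxed_addable bx' bx.
have [kB laB] := boxed_add_lt bx bx'.
apply: eq_window => [||z wz]; first exact: affine_grass_period.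
  apply: periodic_comp; first exact: affine_grass_period.
  by move=> i; exact: affine_transp_period.
have w1 : window (- k%:Z) by rewrite /window; lia.
have w2 : window ((la k)%:Z + 1) by rewrite /window; lia.
rewrite /= affine_transpE // [LHS]affine_grassE // grass_add //.
case: eqP => _.
  by rewrite affine_grassE // grass_col conj_addable //; lia.
by case: eqP => _; rewrite affine_grassE // grass_row.
Qed.

Lemma affine_grass0 : affine_grass (fun _ => 0%N) = id.
Proof.
apply: eq_window => [||z wz] //; first exact: affine_grass_period.
rewrite affine_grassE //; case: (int_case z) => -[k ->]; rewrite ?grass_row ?grass_col.
  by rewrite sub0r.
by rewrite (@conj_eq B _ _ 0%N) //; [rewrite subr0|left].
Qed.

(** Each residue occurs once among [1, ..., n]; the sum in the definition of an
    affine permutation is therefore unchanged when a cell is added. *)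
Lemma sum_residue (a : int) :
  \sum_(1 <= i < n.+1) (residue n i%:Z == residue n a)%:R = 1 :> int.
Proof.
have [i0 i0n i0r] : exists2 i0 : nat,
    i0 \in index_iota 1 n.+1 & residue n i0%:Z = residue n a.
  exists `|((a - 1)%R %% n)%Z|%N.+1; first by rewrite mem_index_iota; lia.
  by apply/eqP/residueP => //; exists (- ((a - 1)%R %/ n)%Z); lia.
rewrite (bigD1_seq i0 i0n (iota_uniq _ _)). rewrite big_nat_cond i0r eqxx.
rewrite big1 ?addr0 //.
move=> i /andP[iin ii0]; rewrite -i0r residue_near //.
  by rewrite eqz_nat (negbTE ii0).
by move: i0n; rewrite mem_index_iota; lia.
Qed.

Lemma affine_grass_add_val la k z : boxed B la -> boxed B (add_box k la) ->
  affine_grass (add_box k la) z = affine_grass la z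
    + (residue n z == residue n (- k%:Z))%:R
    - (residue n z == residue n ((la k)%:Z + 1))%:R.
Proof.
move=> bx bx'; have ad := boxed_addable bx' bx.
have [kB laB] := boxed_add_lt bx bx'.
pose h z := affine_grass la z + (residue n z == residue n (- k%:Z))%:R
    - (residue n z == residue n ((la k)%:Z + 1))%:R.
suff -> : affine_grass (add_box k la) = h by [].
apply: eq_window => [||{}z wz]; first exact: affine_grass_period.
  by move=> i; rewrite /h affine_grass_period residue_period //; lia.
rewrite /h !affine_grassE // grass_add // !residue_near //; first last.
- by apply: window_near => //; rewrite /window; lia.
- by apply: window_near => //; rewrite /window; lia.
case: eqP => [->|_]; first by rewrite grass_row; lia.
case: eqP => [->|_]; last by rewrite addr0 subr0.
by rewrite grass_col conj_addable //= addr0; lia.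
Qed.

Lemma simple_refl_bij r : bijective (simple_refl n r).
Proof. by exists (simple_refl n r); exact: simple_reflK. Qed.

Lemma affine_perm_grass la : boxed B la -> affine_perm n (affine_grass la).
Proof.
move: la; apply: boxed_ind => [|la k bx bx' [bij per sum0]].
  rewrite affine_grass0; split=> //; first by exists id.
  by rewrite big1 // => i _; rewrite subrr.
split; last 1 first.
- pose up (i : nat) : int := (residue n i%:Z == residue n (- k%:Z))%:R.
  pose down (i : nat) : int := (residue n i%:Z == residue n ((la k)%:Z + 1))%:R.
  rewrite (eq_bigr (fun i : nat => affine_grass la i%:Z - i%:Z + (up i - down i))).
    by rewrite big_split /= sum0 add0r sumrB !sum_residue subrr.
  by move=> i _; rewrite affine_grass_add_val // -/(up i) -/(down i); lia.
- rewrite affine_grass_add //; apply: bij_comp => //; exact: simple_refl_bij.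
exact: affine_grass_period.
Qed.

(** This determines the pair chosen by an external insertion, which maximizes
    the value taken at a nonpositive position. *)
Lemma affine_grass_le0 la (a : int) : boxed B la -> a <= 0 -> affine_grass la a <= (la 0%N)%:Z.
Proof.
move=> bx a0; rewrite /affine_grass; set q := (_ %/ _)%Z.
have wy : window (a - q * n%:Z) by rewrite /window /q; lia.
have q0 : q <= 0 by move: wy; rewrite /window; nia.
set y := a - _ in wy *.
have yE : a = y + q * n%:Z by rewrite /y; lia.
case: (int_case y) => -[k kE]; rewrite kE ?grass_row ?grass_col.
  by have := boxed_le bx (leq0n k); nia.
move: wy; rewrite /window kE => wy.
have : q <= -1 by nia.
by nia.
Qed.

(** This determines the pair chosen when a cell of row [j] is bumped: the row
    below is the next one that a nonpositive position can give. *)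
Lemma affine_grass_below la j (a : int) : boxed B la -> a <= 0 -> (j < B)%N ->
  affine_grass la a < (la j)%:Z - j%:Z -> affine_grass la a <= (la j.+1)%:Z - j.+1%:Z.
Proof.
move=> bx a0 jB; rewrite /affine_grass; set q := (_ %/ _)%Z.
have wy : window (a - q * n%:Z) by rewrite /window /q; lia.
have q0 : q <= 0 by move: wy; rewrite /window; nia.
case: (leP 0 q) => q1 lt.
  have -> : q = 0 by lia.
  move: lt; have -> : q = 0 by lia.
  rewrite mul0r subr0 addr0; have -> : a = - `|a|%N%:Z by lia.
  rewrite grass_row => lt; case: (ltnP j `|a|) => ja.
    by have := boxed_le bx ja; lia.
  by have := boxed_le bx ja; lia.
have := grass_window bx wy; rewrite /window; nia.
Qed.

End Grassmannian.

(** * Lengths *)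

Lemma sum_le1 N (P : pred 'I_N) : {in P &, forall i j, i = j} ->
  (\sum_(i < N) P i <= 1)%N.
Proof.
move=> inj; have -> : (\sum_(i < N) P i = \sum_(i | P i) 1)%N.
  by rewrite [RHS]big_mkcond; apply: eq_bigr => i _; case: (P i).
by rewrite sum1_card; apply/card_le1_eqP => i j Pi Pj; rewrite (inj i j).
Qed.

Section Length.
Variables (B n : nat).
Hypothesis n_big : (2 * B + 3 <= n)%N.
Implicit Types (la : nat -> nat) (k c : nat).

Let n_gt1 : (1 < n)%N. Proof. by lia. Qed.

(** Inversions between the [B] last nonpositive and the [B] first positive
    positions; for a Grassmannian permutation these are all its inversions. *)
Definition inversions (w : int -> int) : nat :=
  (\sum_(a < B) \sum_(b < B) (w (b%:Z + 1) < w (- a%:Z))%R)%N.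

(** A simple reflection moves integers by at most one, hence reverses only a
    pair whose two residues are those it exchanges. *)
Lemma simple_refl_lt r x y : residue n x != residue n y ->
  simple_refl n r y < simple_refl n r x ->
  (y < x) || (residue n x == residue n r) && (residue n y == residue n (r + 1)).
Proof.
move=> xy; have : x != y by apply: contra_neq xy => ->.
move: xy; rewrite !simple_reflE //.
have r1 := residue_add1_neq n_gt1 r.
case: (residue n x =P residue n r) => hx; case: (residue n y =P residue n r) => hy;
  rewrite ?hx ?hy ?eqxx //; case: (residue n y =P residue n (r + 1)) => hy1;
  case: (residue n x =P residue n (r + 1)) => hx1;
  rewrite ?orbT ?orbF //; lia.
Qed.

(** At most one of the pairs that are counted takes the two residues exchanged
    by the reflection, since the positions used have distinct residues. *)
Lemma inversions_refl r w :
  (forall x y, residue n x != residue n y -> residue n (w x) != residue n (w y)) ->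
  (inversions (simple_refl n r \o w) <= (inversions w).+1)%N.
Proof.
move=> w_ne.
pose p (a : 'I_B) := residue n (w (- a%:Z)) == residue n r.
pose q (b : 'I_B) := residue n (w (b%:Z + 1)) == residue n (r + 1).
have bound : (inversions (simple_refl n r \o w) <=
    inversions w + \sum_(a < B) \sum_(b < B) p a * q b)%N.
  rewrite /inversions -big_split /=; apply: leq_sum => a _.
  rewrite -big_split /=; apply: leq_sum => b _.
  have ne : residue n (w (- a%:Z)) != residue n (w (b%:Z + 1)).
    by apply: w_ne; rewrite residue_near //; have := ltn_ord a; have := ltn_ord b; lia.
  have := simple_refl_lt (r := r) ne; rewrite -/(p a) -/(q b).
  by case: (simple_refl n r _ < _) => // /(_ isT); case: (w _ < _) => //= /andP[-> ->].
apply: leq_trans bound _; rewrite -addn1 leq_add2l -big_distrlr /=.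
apply: (@leq_mul _ _ 1 1); apply: sum_le1 => i j; rewrite !unfold_in => /eqP hi /eqP hj.
  apply/eqP; apply: contraT => ij; have := w_ne (- i%:Z) (- j%:Z).
  rewrite hi hj eqxx residue_near //; last by have := ltn_ord i; have := ltn_ord j; lia.
  by move=> h; apply: h; move: ij; rewrite -val_eqE /=; lia.
apply/eqP; apply: contraT => ij; have := w_ne (i%:Z + 1) (j%:Z + 1).
rewrite hi hj eqxx residue_near //; last by have := ltn_ord i; have := ltn_ord j; lia.
by move=> h; apply: h; move: ij; rewrite -val_eqE /=; lia.
Qed.

Lemma inversions_word s : (inversions (simple_prod n s) <= size s)%N.
Proof.
elim: s => [|r s IH] /=.
  rewrite /inversions big1 // => a _; rewrite big1 // => b _.
  by rewrite (_ : (_ < _) = false) //=; lia.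
apply: leq_trans (inversions_refl r _) _ => [x y|]; first exact: simple_prod_ne.
by rewrite ltnS.
Qed.

(** The values at [-a] and [b + 1] are inverted exactly when the partition
    contains the cell in row [a] and column [b]. *)
Lemma inversions_grass la : boxed B la -> inversions (affine_grass B n la) = weight B la.
Proof.
move=> bx; apply: eq_bigr => a _.
have aB := ltn_ord a; have := boxed_leB a bx => lB.
transitivity (\sum_(b < B) (b < la a))%N.
  apply: eq_bigr => b _; have bB := ltn_ord b.
  rewrite !affine_grassE //; try (rewrite /window; lia).
  rewrite grass_row grass_col; have := lt_conj b a bx; have := conj_spec b bx.
  by have := @boxed_le B la a (conj B la b) bx; case: (ltnP a (conj B la b)); lia.
transitivity (\sum_(b < B | (b < la a)%N) 1)%N.
  by rewrite [RHS]big_mkcond; apply: eq_bigr => b _; case: (_ < _)%N.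
by rewrite -(big_ord_widen _ (fun=> 1%N)) // sum1_card card_ord.
Qed.
End Length.

(** * Cores *)

Section Cores.
Variables (B n : nat).
Hypothesis n_big : (2 * B + 3 <= n)%N.
Implicit Types (la : nat -> nat) (k c : nat).

Let n_gt1 : (1 < n)%N. Proof. by lia. Qed.

(** The cells of a partition in the box have contents that differ by less than
    [n], so that [simple_act] changes a single cell. *)
Lemma simple_act_shape la k : boxed B la -> boxed B (add_box k la) ->
  simple_act n ((la k)%:Z - k%:Z) (shape B la) = shape B (add_box k la).
Proof.
move=> bx bx'; have ad := boxed_addable bx' bx.
have [kB laB] := boxed_add_lt bx bx'.
have size_le : (size (shape B la) <= B)%N by rewrite shapeE // size_mkseq conj_leB.
have kS : (k <= size (shape B la))%N.
  rewrite shapeE // size_mkseq; move: ad; rewrite /addable.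
  by have := lt_conj 0 k.-1 bx; lia.
have tail r : ((size (shape B la)).+1 <= r)%N -> add_box k la r = 0%N.
  move=> rS; have : ~~ (r < conj B la 0)%N.
    by move: rS; rewrite shapeE // size_mkseq; lia.
  by rewrite lt_conj // /add_box; case: eqP; lia.
rewrite /simple_act [RHS](_ : _ = [seq x <- mkseq (add_box k la) (size (shape B la)).+1 | (0 < x)%N]); last first.
  rewrite -(filter_mkseq tail (M := B.+1)) //.
  by rewrite (filter_mkseq (N := B)) // => r; exact: boxed_eq0.
congr filter; apply/eq_in_map => r; rewrite mem_iota => /andP[_ rS].
rewrite !nth_shape // /add_box.
have rB : (r <= B)%N by lia.
have laB' := boxed_leB r bx.
rewrite !residue_near //; try lia.
have -> : (la r.+1 < la r)%N && ((la r)%:Z - 1 - r%:Z == (la k)%:Z - k%:Z) = false.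
  case: (ltngtP r k) => rk; last by rewrite rk; lia.
    have : (r <= k.-1)%N by lia.
    by move/(boxed_le bx); move: ad; rewrite /addable; lia.
  by have := boxed_le bx (ltnW rk); lia.
rewrite subn0; congr addn; case: (ltngtP r k) => rk /=.
- have : (r <= k)%N by lia.
  by move/(boxed_le bx); case: (_ || _); lia.
- by have := boxed_le bx (ltnW rk); case: (_ || _); lia.
by rewrite rk eqxx andbT -/(addable k la) ad.
Qed.

Lemma grass_word la : boxed B la -> exists s,
  [/\ size s = weight B la, affine_grass B n la = simple_prod n s
    & shape B la = foldr (simple_act n) [::] s].
Proof.
move: la; apply: boxed_ind => [|la k bx bx' [s [sz wE cE]]].
  exists [::]; split; first by rewrite /weight big1.
    exact: affine_grass0.
  exact: shape0.
exists ((la k)%:Z - k%:Z :: s); have [kB laB] := boxed_add_lt bx bx'.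
split; first by rewrite /= sz weight_add.
  by rewrite affine_grass_add //= wE.
by rewrite /= -cE simple_act_shape.
Qed.

Lemma core_of_grass la : boxed B la -> core_of n (affine_grass B n la) (shape B la).
Proof. by case/grass_word => s [_ wE cE]; exists s. Qed.

(** Building the partition cell by cell gives a word of the right size, and
    inversions show that no word is shorter. *)
Lemma has_length_grass la : boxed B la -> has_length n (affine_grass B n la) (weight B la).
Proof.
move=> bx; split; first by case/grass_word: bx => s [sz wE _]; exists s.
by move=> s sE; rewrite -(inversions_grass n_big bx) sE inversions_word.
Qed.

End Cores.

(** * Horizontal strips as weak strips *)

Section Strips.
Variables (B n : nat).
Hypothesis n_big : (2 * B + 3 <= n)%N.
Implicit Types (ka be la : nat -> nat) (k c : nat).

Let n_gt1 : (1 < n)%N. Proof. by lia. Qed.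

(** [be / ka] is a horizontal strip: consecutive rows interlace. *)
Definition hstrip ka be := forall k, (ka k <= be k)%N /\ (be k.+1 <= ka k)%N.

Definition in_row ka be (x : int) k := (ka k)%:Z <= x + k%:Z < (be k)%:Z.

(** The residues of the contents of the cells of [be / ka]. *)
Definition strip_set ka be : {set 'Z_n} :=
  [set x | [exists k : 'I_B, [exists c : 'I_B,
     (ka k <= c < be k)%N && (x == residue n (c%:Z - k%:Z))]]].

Lemma strip_setP ka be (x : int) : boxed B be -> B%:Z - n%:Z <= x <= n%:Z - B%:Z ->
  reflect (exists k, in_row ka be x k) (residue n x \in strip_set ka be).
Proof.
move=> bx xwin; rewrite inE; apply: (iffP existsP) => [[k /existsP[c]]|[k xk]].
  have := ltn_ord k; have := ltn_ord c => cB kB /andP[ck].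
  by rewrite residue_near //; [move/eqP->; exists k; rewrite /in_row|]; lia.
have beB := boxed_leB k bx.
have kB : (k < B)%N.
  by rewrite ltnNge; apply/negP => /(boxed_eq0 bx) be0; move: xk; rewrite /in_row be0; lia.
have xB : (`|(x + k%:Z)%R|%N < B)%N by move: xk; rewrite /in_row; lia.
exists (Ordinal kB); apply/existsP; exists (Ordinal xB); move: xk; rewrite /in_row /= => xk.
by apply/andP; split; [|apply/eqP; congr residue]; lia.
Qed.

Lemma hstrip_le ka be j k : boxed B ka -> hstrip ka be -> (j < k)%N -> (be k <= ka j)%N.
Proof.
move=> bx st; case: k => // k jk; apply: leq_trans (st k).2 _.
exact: boxed_le bx _.
Qed.

(** The contents of distinct rows of a horizontal strip are separated: the
    content following the last cell of a row is that of no cell, and neither is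
    the one preceding the first cell. *)
Lemma row_end ka be k : boxed B ka -> hstrip ka be ->
  ~ exists j, in_row ka be ((be k)%:Z - k%:Z) j.
Proof.
move=> bx st [j]; rewrite /in_row; case: (ltngtP j k) => jk.
- by have := hstrip_le bx st jk; lia.
- by have := hstrip_le bx st jk; have := (st k).1; lia.
by rewrite jk; lia.
Qed.

Lemma row_begin ka be k : boxed B ka -> hstrip ka be ->
  ~ exists j, in_row ka be ((ka k)%:Z - k%:Z - 1) j.
Proof.
move=> bx st [j]; rewrite /in_row; case: (ltngtP j k) => jk.
- by have := boxed_le bx (ltnW jk); lia.
- by have := hstrip_le bx st jk; lia.
by rewrite jk; lia.
Qed.

Lemma strip_set_proper ka be : boxed B be -> strip_set ka be \proper [set: 'Z_n].
Proof.
move=> bx; apply/properP; split; first exact: subsetT.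
exists (residue n B%:Z) => //; apply/(strip_setP ka bx); first by lia.
by move=> [k]; rewrite /in_row; have := boxed_leB k bx; lia.
Qed.

(** At the position of a row, the run of contents of its cells carries the value
    to the end of the row. At the position of a column, the value drops by one
    if the strip has a cell in that column and is fixed otherwise. *)
Lemma cyc_perm_strip ka be : boxed B ka -> boxed B be -> hstrip ka be ->
  cyc_perm (strip_set ka be) \o affine_grass B n ka = affine_grass B n be.
Proof.
move=> bxk bxb st.
have per : periodic n (cyc_perm (strip_set ka be)).
  rewrite /cyc_perm; elim/big_rec: _ => // a f _ hf.
  by apply: periodic_comp => //; exact: simple_prod_period.
apply: (eq_window n_big) => [||z wz]; [|exact: affine_grass_period|].
  by apply: periodic_comp => //; exact: affine_grass_period.
rewrite /= !affine_grassE //; move: wz; rewrite /window.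
case: (int_case z) => -[k ->] wz.
  rewrite !grass_row; have kb := boxed_leB k bxk; have kb' := boxed_leB k bxb.
  rewrite (@cyc_perm_run n n_gt1 _ _ (be k - ka k)).
  - by have := (st k).1; lia.
  - by apply/(strip_setP ka bxb); [lia|exact: row_begin].
  - move=> i ilt; apply/(strip_setP ka bxb); first by lia.
    by exists k; rewrite /in_row; lia.
  have -> : (ka k)%:Z - k%:Z + (be k - ka k)%N%:Z = (be k)%:Z - k%:Z.
    by have := (st k).1; lia.
  by apply/(strip_setP ka bxb); [lia|exact: row_end].
rewrite !grass_col; set t := conj B ka k.
have ltt j : (j < t)%N = (k < ka j)%N by exact: lt_conj.
have tB : (t <= B)%N by exact: conj_leB.
have kat : (ka t <= k)%N by exact: conj_spec.
have pos : t = 0%N \/ (k < ka t.-1)%N by case: (posnP t) => [->|]; [left|right; rewrite -ltt; lia].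
case: (ltnP k (be t)) => bet.
  have -> : conj B be k = t.+1.
    by apply: conj_eq => //; [exact: leq_trans (st t).2 kat|right].
  rewrite cyc_perm_pred ?strip_set_proper //; first by lia.
  by apply/(strip_setP ka bxb); [lia|exists t; rewrite /in_row; lia].
have -> : conj B be k = t.
  apply: conj_eq => //; case: pos => [->|h]; [by left|right].
  exact: leq_trans h (st _).1.
rewrite (@cyc_perm_run n n_gt1 _ _ 0) ?addr0 //.
  apply/(strip_setP ka bxb); first by lia.
  move=> [j]; rewrite /in_row; case: (ltngtP j t) => jt.
  - by have := ltt j; lia.
  - by have := hstrip_le bxk st jt; lia.
  by rewrite jt; lia.
apply/(strip_setP ka bxb); first by lia.
move=> [j]; rewrite /in_row; case: (ltngtP j t) => jt.
- by have := ltt j; lia.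
- by have := hstrip_le bxk st jt; lia.
by rewrite jt; lia.
Qed.

(** The contents of a strip lie in the window, so sets of residues of contents
    can be compared there. *)
Lemma eq_window_set (X Y : {set 'Z_n}) :
  (forall x : int, window B n x -> (residue n x \in X) = (residue n x \in Y)) -> X = Y.
Proof.
move=> XY; apply/setP => a; have [y wy yE] := window_residue n_big (a : nat)%:Z.
by rewrite -(residue_val a) -yE; exact: XY.
Qed.

Lemma residue_window (x y : int) : window B n x -> window B n y ->
  (residue n x == residue n y) = (x == y).
Proof. by move=> wx wy; rewrite residue_near // (window_near n_big wx wy). Qed.

Lemma window_central (x : int) : window B n x -> B%:Z - n%:Z <= x <= n%:Z - B%:Z.
Proof. by rewrite /window; lia. Qed.

Lemma strip_set_add ka be k : boxed B ka -> boxed B be -> boxed B (add_box k be) ->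
  hstrip ka be ->
  strip_set ka (add_box k be) = residue n ((be k)%:Z - k%:Z) |: strip_set ka be.
Proof.
move=> bxk bx bx' st; have [kB bkB] := boxed_add_lt bx bx'.
apply: eq_window_set => x wx; rewrite in_setU1 residue_window //; last by rewrite /window; lia.
have wc := window_central wx; have le_k := (st k).1.
apply/(strip_setP ka bx' wc)/orP => [[j]|[/eqP->|/(strip_setP ka bx wc)[j]]].
- rewrite /in_row /add_box => h; case: (x =P (be k)%:Z - k%:Z) => [_|ne]; [by left|right].
  apply/(strip_setP ka bx wc); exists j; move: h; rewrite /in_row.
  by case: (j =P k) => [->|]; lia.
- by exists k; rewrite /in_row /add_box eqxx; lia.
by move=> h; exists j; move: h; rewrite /in_row /add_box; lia.
Qed.

Lemma strip_set_new ka be k : boxed B ka -> boxed B be -> boxed B (add_box k be) ->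
  hstrip ka be -> residue n ((be k)%:Z - k%:Z) \notin strip_set ka be.
Proof.
move=> bxk bx bx' st; have [kB bkB] := boxed_add_lt bx bx'.
by apply/(strip_setP ka bx); [lia|exact: row_end].
Qed.

(** The cells of a strip have distinct residues: removing a cell of the strip
    removes its residue. *)
Lemma card_strip_set ka be : boxed B ka -> boxed B be -> hstrip ka be ->
  weight B be = (weight B ka + #|strip_set ka be|)%N.
Proof.
move=> bxk; move eqw: (weight B be) => w.
elim/ltn_ind: w be eqw => w IH be wE bx st.
case: (boolP [exists k : 'I_B, (ka k < be k)%N]) => [/existsP[k lt]|/existsPn none].
  pose be' r := (be r - (r == k :> nat))%N.
  have beE : be = add_box k be'.
    apply: functional_extensionality => r; rewrite /add_box /be'.
    by case: eqP => [->|_]; lia.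
  have st' : hstrip ka be'.
    move=> r; have [] := st r; rewrite /be'.
    by case: (r =P k :> nat) => [->|_]; lia.
  have bx' : boxed B be'.
    case: (bx) => dec be0 beB; split; rewrite /be' ?beB //; last by lia.
    move=> r; have := dec r; case: (r =P k :> nat) => [->|_]; last by lia.
    by have := (st k).2; lia.
  have kB := ltn_ord k.
  have wE' : w = (weight B be').+1 by rewrite -wE beE weight_add.
  rewrite beE strip_set_add -?beE // cardsU1 strip_set_new -?beE //.
  by rewrite wE' (IH _ _ be' erefl) //; lia.
have be_ka (k : 'I_B) : be k = ka k.
  by have := none k; rewrite -leqNgt; have := (st k).1; lia.
rewrite -wE /weight (eq_bigr (fun k : 'I_B => ka k)) // [#|_|](_ : _ = 0%N) ?addn0 //.
apply/eqP; rewrite cards_eq0; apply/eqP/setP => x; rewrite !inE.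
by apply/existsP => -[k /existsP[c]]; rewrite be_ka; lia.
Qed.

End Strips.

(** * Strong and weak strips between small partitions *)

Section Bumping.
Variable B : nat.
Implicit Types (ka be : nat -> nat) (k : nat).

(** The row to which the cell that [add_box] puts in row [k] of [ka] is carried:
    if that cell already belongs to [be], it is bumped to the next row. *)
Definition bump_row ka be k := if (ka k < be k)%N then k.+1 else k.

Lemma hstrip_bump ka be k : boxed B ka -> boxed B (add_box k ka) -> hstrip ka be ->
  hstrip (add_box k ka) (add_box (bump_row ka be k) be).
Proof.
move=> bx bx' st j; have [ad1 ad2] := st j; have ad := boxed_addable bx' bx.
rewrite /bump_row /add_box; case: ltnP => lt.
  rewrite eqSS; split; last by lia.
  by case: (j =P k) => [->|_]; lia.
have kE : ka k = be k by have := (st k).1; lia.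
split; first by lia.
case: (j.+1 =P k) => [jk|]; last by lia.
by move: ad; rewrite /addable -jk /= jk kE; lia.
Qed.

Lemma boxed_bump ka be k : boxed B ka -> boxed B (add_box k ka) -> boxed B be ->
  hstrip ka be -> (k.+1 < B)%N -> boxed B (add_box (bump_row ka be k) be).
Proof.
move=> bxk bxk' bxb st kB; have ad := boxed_addable bxk' bxk.
have [_ kaB] := boxed_add_lt bxk bxk'; have le_k := (st k).1.
rewrite /bump_row; case: ltnP => lt; apply: boxed_add => //; try lia.
- by rewrite /addable /=; have := (st k).2; lia.
- by have := (st k).2; have := boxed_leB k bxb; lia.
by move: ad; rewrite /addable; have := (st k.-1).1; lia.
Qed.

End Bumping.

Section Insertion.
Variables (B n : nat).
Hypothesis n_big : (B * B + 2 * B + 3 <= n)%N.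
Implicit Types (ka be la mu : nat -> nat) (k c : nat) (rows out : seq nat).

Let n_big' : (2 * B + 3 <= n)%N. Proof. by lia. Qed.
Let n_gt1 : (1 < n)%N. Proof. by lia. Qed.
Local Notation G := (affine_grass B n).

(** The marked strong cover that adds a cell at the end of row [k]. *)
Definition cover la k : strong_cover :=
  StrongCover (G la) (- k%:Z) ((la k)%:Z + 1) (G (add_box k la)).

Fixpoint covers la rows : seq strong_cover :=
  if rows is k :: rows' then cover la k :: covers (add_box k la) rows' else [::].

Definition add_boxes la rows := foldl (fun la k => add_box k la) la rows.

Fixpoint addable_rows la rows : Prop :=
  if rows is k :: rows' then
    boxed B (add_box k la) /\ addable_rows (add_box k la) rows'
  else True.

Definition strong la rows : strong_strip := StrongStrip (G la) (covers la rows).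

Definition weak ka be : weak_strip n := WeakStrip (G ka) (strip_set B n ka be) (G be).

Lemma add_boxes_rcons la rows k :
  add_boxes la (rcons rows k) = add_box k (add_boxes la rows).
Proof. by rewrite /add_boxes -cats1 foldl_cat. Qed.

Lemma covers_rcons la rows k :
  covers la (rcons rows k) = rcons (covers la rows) (cover (add_boxes la rows) k).
Proof. by elim: rows la => //= r rows IH la; rewrite IH. Qed.

Lemma addable_rows_rcons la rows k : addable_rows la rows ->
  boxed B (add_box k (add_boxes la rows)) -> addable_rows la (rcons rows k).
Proof. by elim: rows la => //= r rows IH la [bx ad] bx'; split; last exact: IH. Qed.

Lemma add_boxesE la rows k : add_boxes la rows k = (la k + count_mem k rows)%N.
Proof.
elim: rows la => [|r rows IH] la /=; first by rewrite addn0.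
by rewrite IH /add_box eq_sym addnA.
Qed.

Lemma boxed_add_boxes la rows : boxed B la -> addable_rows la rows ->
  boxed B (add_boxes la rows).
Proof. by elim: rows la => //= r rows IH la bx [bx' ad]; apply: IH. Qed.

Lemma ss_out_strong la rows : ss_out (strong la rows) = G (add_boxes la rows).
Proof. by rewrite /ss_out /=; elim: rows la => //= r rows IH la; rewrite IH. Qed.

Lemma is_strong_cover_cover la k : boxed B la -> boxed B (add_box k la) ->
  is_strong_cover n 0 (cover la k).
Proof.
move=> bx bx'; have [kB laB] := boxed_add_lt bx bx'.
have ne : residue n (- k%:Z) != residue n ((la k)%:Z + 1).
  by rewrite residue_near //; lia.
split => //=; last by lia.
- by split; apply: affine_perm_grass.
- split; last by exists (- k%:Z), ((la k)%:Z + 1); split => //; exact: affine_grass_transp.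
  exists (weight B la); first exact: has_length_grass.
  by rewrite addn1 -(weight_add la kB); exact: has_length_grass.
exact: affine_grass_transp.
Qed.

Lemma affine_grass_mark la k : boxed B la -> boxed B (add_box k la) ->
  G la ((la k)%:Z + 1) = (la k)%:Z + 1 - k%:Z.
Proof.
move=> bx bx'; have [kB laB] := boxed_add_lt bx bx'.
rewrite affine_grassE //; last by rewrite /window; lia.
by rewrite grass_col conj_addable // (boxed_addable bx' bx).
Qed.

(** Adding cells row by row from the bottom up, each row from left to right,
    visits the contents in increasing order. *)
Lemma is_strong_strip_strong la rows : boxed B la -> addable_rows la rows ->
  sorted geq rows -> is_strong_strip n 0 (strong la rows).
Proof.
move=> bx ad so; split => /=; first exact: affine_perm_grass.
  elim: rows la bx ad {so} => //= r rows IH la bx [bx' ad].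
  by split=> //; [exact: is_strong_cover_cover | exact: IH].
elim: rows la bx ad so => //= r [|r' rows] IH la bx [bx' ad] //= /andP[rr' so].
apply/andP; split; last exact: IH.
have [bx'' _] := ad; rewrite /sc_mark /= !affine_grass_mark // /add_box.
have le_r : (r' <= r)%N := rr'; have := boxed_le bx le_r.
by case: (r' =P r) => [->|ne]; lia.
Qed.

Lemma is_weak_strip_weak ka be : boxed B ka -> boxed B be -> hstrip ka be ->
  is_weak_strip (weak ka be).
Proof.
move=> bxk bxb st; split=> /=.
- by split; apply: affine_perm_grass.
- exact: strip_set_proper.
- by rewrite cyc_perm_strip.
exists (weight B ka); first exact: has_length_grass.
by rewrite -(card_strip_set n_big') //; exact: has_length_grass.
Qed.

(** Row [k] has no cell of the strip, neither before nor after. *)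
Lemma strip_set_both ka be k : ka k = be k -> boxed B be -> boxed B (add_box k be) ->
  strip_set B n (add_box k ka) (add_box k be) = strip_set B n ka be.
Proof.
move=> kE bx bx'; apply: (eq_window_set n_big') => x wx; have wc := window_central n_big' wx.
apply/(strip_setP n_big' _ bx' wc)/(strip_setP n_big' _ bx wc) => -[j]; rewrite /in_row /add_box => h.
  by exists j; move: h; case: (j =P k) => [->|]; rewrite ?kE; lia.
by exists j; move: h; case: (j =P k) => [->|]; rewrite ?kE; lia.
Qed.

(** Row [k] of the strip loses its first cell, and row [k + 1] gains a cell at
    its end. *)
Lemma strip_set_bump ka be k : boxed B ka -> boxed B (add_box k ka) -> boxed B be ->
  boxed B (add_box k.+1 be) -> hstrip ka be -> (ka k < be k)%N ->
  strip_set B n (add_box k ka) (add_box k.+1 be) =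
  residue n ((be k.+1)%:Z - k.+1%:Z) |: (strip_set B n ka be :\ residue n ((ka k)%:Z - k%:Z)).
Proof.
move=> bxk bxk' bxb bxb' st lt.
have [kB kaB] := boxed_add_lt bxk bxk'; have [kB' beB] := boxed_add_lt bxb bxb'.
have [st1 _] := st k.+1; have [_ st2] := st k.
apply: (eq_window_set n_big') => x wx; have wc := window_central n_big' wx.
rewrite in_setU1 in_setD1 !(residue_window n_big') //; try (rewrite /window; lia).
apply/(strip_setP n_big' _ bxb' wc)/orP => [[j]|[/eqP->|/andP[/eqP ne /(strip_setP n_big' _ bxb wc)[j]]]].
- rewrite /in_row /add_box => h; case: (x =P (be k.+1)%:Z - k.+1%:Z) => [_|ne]; [by left|right].
  have lt_j : (k < j)%N -> (be j <= ka k)%N by exact: hstrip_le bxk st.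
  have le_j : (j <= k)%N -> (ka k <= ka j)%N by exact: boxed_le bxk.
  apply/andP; split.
    by apply/eqP => xE; move: h lt_j le_j; case: (ltngtP j k) => jk; lia.
  apply/(strip_setP n_big' _ bxb wc); exists j; move: h; rewrite /in_row.
  by case: (j =P k.+1) => [->|]; lia.
- by exists k.+1; rewrite /in_row /add_box eqxx; lia.
move=> h; exists j; move: h; rewrite /in_row /add_box.
by case: (j =P k) => [->|]; lia.
Qed.

End Insertion.

(** * Insertion of one cell *)

Section Steps.
Variables (B n : nat).
Hypothesis n_big : (B * B + 2 * B + 3 <= n)%N.
Implicit Types (ka be la mu : nat -> nat) (k c : nat) (rows out : seq nat).

Let n_big' : (2 * B + 3 <= n)%N. Proof. by lia. Qed.
Let n_gt1 : (1 < n)%N. Proof. by lia. Qed.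
Local Notation G := (affine_grass B n).
Local Notation cover := (cover B n).
Local Notation strong := (strong B n).
Local Notation weak := (weak B n).

Lemma affine_grass_row la k : (k <= B)%N -> G la (- k%:Z) = (la k)%:Z - k%:Z.
Proof. by move=> kB; rewrite affine_grassE ?grass_row // /window; lia. Qed.

Lemma affine_grass_col la c : (c <= B)%N -> G la (c%:Z + 1) = c%:Z + 1 - (conj B la c)%:Z.
Proof. by move=> kB; rewrite affine_grassE ?grass_col // /window; lia. Qed.

Lemma strong_rcons mu out k :
  strong mu (rcons out k) = add_cover (strong mu out) (cover (add_boxes mu out) k).
Proof. by rewrite /strong covers_rcons. Qed.

Lemma final_pair_grass ka be mu out : boxed B ka -> boxed B mu -> hstrip ka be ->
  addable_rows B mu out -> sorted geq out -> add_boxes mu out = be ->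
  final_pair 0 (weak ka be) (strong mu out).
Proof.
move=> bxk bxm st ad so beE; have bxb : boxed B be by rewrite -beE; apply: boxed_add_boxes.
split; first exact: is_weak_strip_weak.
  exact: is_strong_strip_strong.
by rewrite ss_out_strong beE.
Qed.

Lemma last_cover mu out cs C : covers B n mu out = rcons cs C ->
  exists2 r, r \in out & sc_i C = - r%:Z.
Proof.
case/lastP: out => [|out r]; first by case: cs.
rewrite covers_rcons => /rcons_inj[_ <-]; exists r => //.
by rewrite mem_rcons mem_head.
Qed.

(** The rule [InternalB] moves the cell to the next row: the nice integer [q] is
    the start of row [k + 1], and the next nice integer [p] follows the content
    of the cell that extends that row. *)
Lemma internal_rule_bump ka be mu out k :
  boxed B ka -> boxed B (add_box k ka) -> boxed B be -> boxed B (add_box k.+1 be) ->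
  hstrip ka be -> add_boxes mu out = be -> (ka k < be k)%N -> k \notin out ->
  internal_rule 0 (cover ka k) (weak ka be) (strong mu out)
    (weak (add_box k ka) (add_box k.+1 be)) (strong mu (rcons out k.+1)).
Proof.
move=> bxk bxk' bxb bxb' st beE lt kout.
have [kB kaB] := boxed_add_lt bxk bxk'; have [kB' beB] := boxed_add_lt bxb bxb'.
have [st1 _] := st k.+1; have [_ st2] := st k.
have st' := hstrip_bump bxk bxk' st; rewrite /bump_row lt in st'.
have ui : G (add_box k ka) (- k%:Z) - 1 = (ka k)%:Z - k%:Z.
  by rewrite affine_grass_row; [rewrite /add_box eqxx|]; lia.
have uj : G (add_box k ka) ((ka k)%:Z + 1) = (ka k)%:Z - k%:Z.
  rewrite affine_grassE //; last by rewrite /window; lia.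
  by rewrite grass_add // ifF ?eqxx //; lia.
pose q := (ka k.+1)%:Z - k.+1%:Z; pose p := (be k.+1)%:Z - k.+1%:Z + 1.
have setE : residue n (p - 1) |: (strip_set B n ka be :\ residue n ((ka k)%:Z - k%:Z)) =
    strip_set B n (add_box k ka) (add_box k.+1 be) by rewrite /p addrK strip_set_bump.
have in_window x : q - 1 <= x <= p -> B%:Z - n%:Z <= x <= n%:Z - B%:Z by rewrite /q /p; lia.
have := @InternalB n 0 (cover ka k) (weak ka be) (strong mu out) q p
  (- k.+1%:Z) ((be k.+1)%:Z + 1).
rewrite /= ui uj setE cyc_perm_strip // strong_rcons beE; apply.
- rewrite affine_grass_row ?affine_grass_col; try lia.
  by have := lt_conj (ka k) k bxb; lia.
- by move=> cs C1 /last_cover[r rout ->] /eqP; rewrite eqr_opp eqz_nat => /eqP rk; rewrite -rk rout in kout.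
- split.
  + split.
    * rewrite /nice in_setD negb_and; apply/orP; right.
      apply/(strip_setP n_big' _ bxb); first by apply: in_window; rewrite /p /q; lia.
      exact: row_begin bxk st.
    * rewrite /nice in_setD negb_and /p addrK; apply/orP; right.
      apply/(strip_setP n_big' _ bxb); first by apply: in_window; rewrite /p /q; lia.
      exact: row_end bxk st.
    * by rewrite /p /q; lia.
    * move=> r rqp; rewrite /nice negbK in_setD1.
      have rw : B%:Z - n%:Z <= r - 1 <= n%:Z - B%:Z by apply: in_window; lia.
      apply/andP; split; first by rewrite residue_near //; move: rqp rw; rewrite /p /q; lia.
      apply/(strip_setP n_big' _ bxb rw); exists k.+1; move: rqp; rewrite /in_row /p /q; lia.
  + split; first by rewrite /q; lia.
    exists (- k.+1%:Z); last by lia.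
    by rewrite affine_grass_row // /add_box /q; lia.
  move=> q' p' _ [q'lt [a ua a0]].
  have := affine_grass_below n_big' (j := k) bxk' a0 kB; rewrite ua /add_box eqxx.
  by rewrite /q; case: (k.+1 =P k) => [|_]; lia.
- by rewrite affine_grass_row // /add_box /q; lia.
rewrite affine_grass_col; last by lia.
rewrite (@conj_eq B _ _ k.+1) //; first by rewrite /p; lia.
  by rewrite /add_box; lia.
by right; rewrite /= /add_box eqxx; lia.
Qed.

Lemma internal_rule_keep ka be mu out k :
  boxed B ka -> boxed B (add_box k ka) -> boxed B be -> boxed B (add_box k be) ->
  hstrip ka be -> add_boxes mu out = be -> be k = ka k ->
  internal_rule 0 (cover ka k) (weak ka be) (strong mu out)
    (weak (add_box k ka) (add_box k be)) (strong mu (rcons out k)).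
Proof.
move=> bxk bxk' bxb bxb' st beE kE.
have [kB kaB] := boxed_add_lt bxk bxk'.
have st' : hstrip (add_box k ka) (add_box k be).
  by have := hstrip_bump bxk bxk' st; rewrite /bump_row kE ltnn.
have := @InternalA n 0 (cover ka k) (weak ka be) (strong mu out).
rewrite /= -(strip_set_both n_big (k := k)) // cyc_perm_strip // strong_rcons beE.
rewrite /cover kE; apply.
rewrite affine_grass_row ?affine_grass_col; try lia.
by rewrite -kE conj_addable // ?(boxed_addable bxb') //; lia.
Qed.

(** The rule [InternalC] never applies, because no cell has been added to row
    [k] as long as the cells of that row are bumped. *)
Lemma internal_step ka be mu out k :
  boxed B ka -> boxed B (add_box k ka) -> boxed B mu -> hstrip ka be ->
  addable_rows B mu out -> sorted geq out -> add_boxes mu out = be ->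
  (k.+1 < B)%N -> ((ka k < be k)%N -> k \notin out) ->
  sorted geq (rcons out (bump_row ka be k)) ->
  internal_insertion 0 (cover ka k) (weak ka be) (strong mu out)
    (weak (add_box k ka) (add_box (bump_row ka be k) be))
    (strong mu (rcons out (bump_row ka be k))).
Proof.
move=> bxk bxk' bxm st ad so beE kB kout so'.
have bxb : boxed B be by rewrite -beE; apply: boxed_add_boxes.
have bxb' := boxed_bump bxk bxk' bxb st kB.
split.
- by split => //; exact: is_strong_cover_cover.
- exact: final_pair_grass.
- move: bxb'; rewrite /bump_row; case: ltnP => lt bxb'.
    by apply: internal_rule_bump => //; exact: kout.
  by apply: internal_rule_keep => //; have := (st k).1; lia.
apply: final_pair_grass => //; first exact: hstrip_bump bxk bxk' st.
  by apply: addable_rows_rcons => //; rewrite beE.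
by rewrite add_boxes_rcons beE.
Qed.

(** The largest value taken at a nonpositive position is the end of the first
    row, and all integers from there on are bad. *)
Lemma external_step ka be mu out :
  boxed B ka -> boxed B mu -> hstrip ka be ->
  addable_rows B mu out -> sorted geq out -> add_boxes mu out = be -> (be 0%N < B)%N ->
  external_insertion 0 (weak ka be) (strong mu out)
    (weak ka (add_box 0 be)) (strong mu (rcons out 0%N)).
Proof.
move=> bxk bxm st ad so beE beB.
have bxb : boxed B be by rewrite -beE; apply: boxed_add_boxes.
have bxb' : boxed B (add_box 0 be) by apply: boxed_add => //; lia.
have st' : hstrip ka (add_box 0 be).
  by move=> k; have := st k; rewrite /add_box; lia.
have cardW : (#|strip_set B n ka be| <= B * B)%N.
  by have := card_strip_set n_big' bxk bxb st; have := weight_le bxb; lia.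
have bad_ge (x : int) : (be 0%N)%:Z <= x <= n%:Z - B%:Z -> bad (strip_set B n ka be) x.
  move=> xw; apply/(strip_setP n_big' _ bxb); first by lia.
  by move=> [j]; rewrite /in_row; have := boxed_le bxb (leq0n j); lia.
split; first exact: final_pair_grass.
- by apply: leq_ltn_trans cardW _; lia.
- rewrite /=; exists ((be 0%N)%:Z - 0%N%:Z), ((be 0%N)%:Z + 1), (- 0%N%:Z), ((be 0%N)%:Z + 1).
  have v0 : G be (- 0%N%:Z) = (be 0%N)%:Z - 0%N%:Z by apply: affine_grass_row.
  split => //.
  + split.
    * split; try (by apply: bad_ge; lia); first by lia.
      by move=> r rlt; exfalso; lia.
    * by exists (- 0%N%:Z).
    by move=> q' p' _ [a <- a0]; have := affine_grass_le0 n_big' bxb a0; lia.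
  + rewrite affine_grass_col; last by lia.
    by rewrite (@conj_eq B _ _ 0%N) //; [lia|left].
  + by rewrite -(strip_set_add n_big') // cyc_perm_strip.
  by rewrite strong_rcons beE.
apply: final_pair_grass => //.
- by apply: addable_rows_rcons => //; rewrite beE.
- by case: (out) so => //= r s; rewrite rcons_path /= => ->.
by rewrite add_boxes_rcons beE.
Qed.

End Steps.

(** * The local rule on partitions *)

Lemma sorted_rcons_last (T : eqType) (leT : rel T) (s : seq T) x : sorted leT s ->
  (forall y, y \in s -> leT y x) -> sorted leT (rcons s x).
Proof.
case: s => //= a s so le; rewrite rcons_path so /=; apply: le.
by rewrite mem_last.
Qed.

Lemma sorted_geq_head k (s : seq nat) : sorted geq (k :: s) -> forall r, r \in s -> (r <= k)%N.
Proof.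
by move=> /= /(order_path_min (rev_trans leq_trans))/allP.
Qed.

(** The rows of the cells that internal insertion adds. *)
Fixpoint bump_rows ka be (rows : seq nat) : seq nat :=
  if rows is k :: rows' then
    let k' := bump_row ka be k in
    k' :: bump_rows (add_box k ka) (add_box k' be) rows'
  else [::].

(** Rows are processed from the bottom up, so a row has received no bumped cell
    yet when its own cells are inserted, and the cells common to both strips
    come first in their row. *)
Lemma count_bump_rows ka be rows k : sorted geq rows ->
  count_mem k (bump_rows ka be rows) =
  (count_mem k rows - minn (count_mem k rows) (be k - ka k) +
   (if k is j.+1 then minn (count_mem j rows) (be j - ka j) else 0))%N.
Proof.
elim: rows ka be => [|r rows IH] ka be so /=; first by case: k => *; rewrite !min0n.
rewrite {}IH; last exact: path_sorted so.
have count_gt j : (r < j)%N -> count_mem j rows = 0%N.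
  by move=> rj; apply/count_memPn/negP => /(sorted_geq_head so); lia.
have := count_gt k; have := count_gt k.-1; rewrite /bump_row /add_box {count_gt so}.
case: (ltnP (ka r) (be r)) => lt; case: k => [|k] /= gt0 gt0';
  repeat (case: eqP => ?; try (exfalso; lia)); try subst r; rewrite /= ?addn0 ?add0n; lia.
Qed.

(** The rows of the cells of [nu / la] in the only order that makes the marks
    increase. *)
Definition strip_rows B (la nu : nat -> nat) : seq nat :=
  sort geq (flatten [seq nseq (nu k - la k) k | k <- iota 0 B]).

Lemma geq_total : total geq. Proof. by move=> x y; exact: leq_total. Qed.

Lemma strip_rows_sorted B la nu : sorted geq (strip_rows B la nu).
Proof. exact/sort_sorted/geq_total. Qed.

Lemma count_flatten_nseq (T : eqType) (f : T -> nat) (s : seq T) k : uniq s ->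
  count_mem k (flatten [seq nseq (f j) j | j <- s]) = if k \in s then f k else 0%N.
Proof.
elim: s => //= j s IH /andP[js us]; rewrite count_cat count_nseq IH // inE /= eq_sym.
by case: eqP => [->|_] /=; rewrite ?mul1n ?mul0n // (negbTE js) addn0.
Qed.

Lemma count_strip_rows B la nu k : boxed B nu ->
  count_mem k (strip_rows B la nu) = (nu k - la k)%N.
Proof.
move=> bx; rewrite /strip_rows (permP (permEl (perm_sort _ _))).
rewrite (count_flatten_nseq (fun k => nu k - la k)%N) ?iota_uniq // mem_iota /= add0n.
by case: ltnP => // kB; rewrite (boxed_eq0 bx kB).
Qed.

Lemma add_strip_rows B la nu : boxed B nu -> (forall k, (la k <= nu k)%N) ->
  add_boxes la (strip_rows B la nu) = nu.
Proof.
move=> bx le; apply: functional_extensionality => k.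
by rewrite add_boxesE (count_strip_rows _ _ bx) subnKC.
Qed.

(** A sorted word of rows is determined by the cells it adds, so the strong strips
    of the growth diagram depend only on its shapes. *)
Lemma strip_rows_unique B mu rho out : boxed B rho -> sorted geq out ->
  add_boxes mu out = rho -> out = strip_rows B mu rho.
Proof.
move=> bx so rhoE; apply: (@sorted_eq _ geq).
- exact: rev_trans leq_trans.
- by move=> x y; rewrite andbC; exact: anti_leq.
- by [].
- exact: strip_rows_sorted.
apply/allP => k _ /=; rewrite (count_strip_rows _ _ bx) -rhoE add_boxesE.
by rewrite addKn.
Qed.

(** Rows stay in order because x_{k+1} <= nu_{k+1} <= la_k <= x_k. *)
Lemma boxed_between B la nu x : boxed B nu -> hstrip la nu ->
  (forall k, (la k <= x k <= nu k)%N) -> boxed B x.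
Proof.
move=> bx st btw; case: (bx) => _ nu0 nuB; split.
- by move=> k; have := btw k; have := btw k.+1; have := st k; lia.
- by have := btw 0%N; lia.
by have := btw B; lia.
Qed.

Lemma addable_between B la nu x rows : boxed B nu -> hstrip la nu ->
  (forall k, (la k <= x k)%N) -> (forall k, (add_boxes x rows k <= nu k)%N) ->
  addable_rows B x rows.
Proof.
move=> bx st; elim: rows x => //= r rows IH x lo hi; split; last first.
  by apply: IH => // k; have := lo k; rewrite /add_box; lia.
apply: (boxed_between bx st) => k; have := hi k; have := lo k.
by rewrite add_boxesE /add_box; lia.
Qed.

(** The local rule of row insertion: cells common to the two strips in a row
    move to the next row, and [e] new cells enter the first row. *)
Definition rsk_rule (la mu nu : nat -> nat) (e : nat) : nat -> nat := fun k =>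
  (maxn (mu k) (nu k) + if k is j.+1 then minn (mu j) (nu j) - la j else e)%N.

Lemma hstrip_rsk_rule la mu nu e : hstrip la mu -> hstrip la nu ->
  hstrip mu (rsk_rule la mu nu e) /\ hstrip nu (rsk_rule la mu nu e).
Proof.
by move=> st st'; split=> k; have := st k; have := st' k; rewrite /rsk_rule; lia.
Qed.

Section LocalRule.
Variables (B n : nat).
Hypothesis n_big : (B * B + 2 * B + 3 <= n)%N.
Implicit Types (ka be la mu nu : nat -> nat) (k c : nat) (rows out : seq nat).

Let n_big' : (2 * B + 3 <= n)%N. Proof. by lia. Qed.
Local Notation strong := (strong B n).
Local Notation weak := (weak B n).

(** The last hypothesis makes the word of rows stay sorted and keeps [InternalC]
    out: a row that already received a cell only gets cells that stay in it. *)
Lemma internal_steps ka be mu rows out :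
  boxed B ka -> addable_rows B ka rows -> sorted geq rows ->
  (forall k, k \in rows -> (k.+1 < B)%N) ->
  boxed B mu -> hstrip ka be -> addable_rows B mu out -> sorted geq out ->
  add_boxes mu out = be ->
  (forall k r, k \in rows -> r \in out -> (k <= r)%N /\ (k = r -> be k = ka k)) ->
  let new := bump_rows ka be rows in
  [/\ internal_insertions 0 (covers B n ka rows) (weak ka be) (strong mu out)
        (weak (add_boxes ka rows) (add_boxes be new)) (strong mu (out ++ new)),
      hstrip (add_boxes ka rows) (add_boxes be new),
      addable_rows B mu (out ++ new) & sorted geq (out ++ new)].
Proof.
elim: rows ka be out => [|k rows IH] ka be out bxk /=; first by rewrite cats0.
move=> [bxk' adr] so rB bxm st ado soo beE compat.
have kB : (k.+1 < B)%N by apply: rB; rewrite mem_head.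
have bxb : boxed B be by rewrite -beE; apply: boxed_add_boxes.
have kout : (ka k < be k)%N -> k \notin out.
  by move=> lt; apply/negP => /(compat k k (mem_head _ _))[_ /(_ erefl)]; lia.
set k' := bump_row ka be k.
have k'_le r : r \in out -> (k' <= r)%N.
  move=> rout; have [kr krE] := compat k r (mem_head _ _) rout.
  rewrite /k' /bump_row; case: ltnP => // lt.
  by rewrite ltn_neqAle kr andbT; apply/eqP => /krE; lia.
have so' := sorted_rcons_last soo k'_le.
have step := internal_step n_big bxk bxk' bxm st ado soo beE kB kout so'.
have bxb' := boxed_bump bxk bxk' bxb st kB.
have := IH (add_box k ka) (add_box k' be) (rcons out k') bxk' adr (path_sorted so) _ bxm
  (hstrip_bump bxk bxk' st) _ so'.
rewrite /= cat_rcons add_boxes_rcons beE; case=> //.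
- by move=> j jr; apply: rB; rewrite inE jr orbT.
- by apply: addable_rows_rcons => //; rewrite beE.
- move=> j r jr; have jk := sorted_geq_head so jr.
  rewrite mem_rcons inE => /predU1P[->|rout].
    rewrite /k' /bump_row; case: ltnP => lt; first by split; lia.
    split=> // jE; subst j; rewrite /add_box eqxx.
    by have := (st k).1; lia.
  have [kr krE] := compat k r (mem_head _ _) rout.
  split; first by exact: leq_trans jk kr.
  move=> jE; subst j; have kE : k = r by apply/eqP; rewrite eqn_leq kr jk.
  subst r; rewrite /k' /bump_row krE // ltnn /add_box eqxx.
  by rewrite krE.
move=> ins st' ad' so''; split => //.
by exists (weak (add_box k ka) (add_box k' be)), (strong mu (rcons out k')).
Qed.

Lemma external_steps e ka be mu out :
  boxed B ka -> boxed B mu -> hstrip ka be ->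
  addable_rows B mu out -> sorted geq out -> add_boxes mu out = be ->
  (be 0%N + e <= B)%N ->
  [/\ external_insertions 0 e (weak ka be) (strong mu out)
        (weak ka (add_boxes be (nseq e 0%N))) (strong mu (out ++ nseq e 0%N)),
      addable_rows B mu (out ++ nseq e 0%N) & sorted geq (out ++ nseq e 0%N)].
Proof.
elim: e be out => [|e IH] be out bxk bxm st ado soo beE beB /=; first by rewrite cats0.
have bxb : boxed B be by rewrite -beE; apply: boxed_add_boxes.
have be0B : (be 0%N < B)%N by lia.
have step := external_step n_big bxk bxm st ado soo beE be0B.
have := IH (add_box 0 be) (rcons out 0%N) bxk bxm.
rewrite cat_rcons; case.
- by move=> k; have := st k; rewrite /add_box; lia.
- apply: addable_rows_rcons => //; rewrite beE; apply: boxed_add => //; lia.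
- exact: sorted_rcons_last.
- by rewrite add_boxes_rcons beE.
- by rewrite /add_box; lia.
move=> ext ad' so'; split => //.
by exists (weak ka (add_box 0 be)), (strong mu (rcons out 0%N)).
Qed.

(** Internal insertion followed by [e] external ones fills the rows from the
    bottom up, so the resulting strong strip is the one that [strip_rows]
    prescribes; counting its cells row by row gives [rsk_rule]. *)
Lemma local_rule_rsk la mu nu e :
  boxed B la -> boxed B mu -> boxed B nu -> boxed B (rsk_rule la mu nu e) ->
  nu B.-1 = 0%N -> hstrip la mu -> hstrip la nu ->
  let rho := rsk_rule la mu nu e in
  local_rule 0 (weak la mu) (strong la (strip_rows B la nu)) e
    (weak nu rho) (strong mu (strip_rows B mu rho)).
Proof.
move=> bxl bxm bxn bxr nuB stm stn rho.
set rows := strip_rows B la nu.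
have rowsE : add_boxes la rows = nu by apply: add_strip_rows => // k; exact: (stn k).1.
have so : sorted geq rows by exact: strip_rows_sorted.
have ad : addable_rows B la rows.
  by apply: (addable_between bxn stn) => // k; rewrite rowsE.
have rB k : k \in rows -> (k.+1 < B)%N.
  move=> kr; rewrite ltnNge; apply/negP => kB.
  have : (0 < count_mem k rows)%N by rewrite -has_count has_pred1.
  rewrite (count_strip_rows _ _ bxn).
  by have : (B.-1 <= k)%N; [lia | move/(boxed_le bxn); lia].
have [] := @internal_steps la mu mu rows [::] bxl ad so rB bxm stm I isT erefl.
  by [].
rewrite cat0s rowsE; set new := bump_rows la mu rows => int st' adn son.
have rhoE : add_boxes (add_boxes mu new) (nseq e 0%N) = rho.
  apply: functional_extensionality => k.
  rewrite !add_boxesE count_nseq /new count_bump_rows // !(count_strip_rows _ _ bxn) //.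
  rewrite /rho /rsk_rule; have := stm k; have := stn k.
  case: k => [|k] /=; first by lia.
  by rewrite (count_strip_rows _ _ bxn); have := stm k; have := stn k; lia.
have rho0 : (add_boxes mu new 0%N + e <= B)%N.
  have [_ le _] := bxr; apply: leq_trans le; rewrite -/rho -rhoE [in X in (_ <= X)%N]add_boxesE.
  by rewrite count_nseq /= mul1n.
have [ext ad' so'] := external_steps bxn bxm st' adn son erefl rho0.
have outE : new ++ nseq e 0%N = strip_rows B mu rho.
  by apply: strip_rows_unique => //; rewrite /add_boxes foldl_cat.
rewrite outE rhoE in ext ad' so'.
split.
- by split=> //; [exact: is_weak_strip_weak | exact: is_strong_strip_strong].
- by have := card_strip_set n_big' bxl bxm stm; have := weight_le bxm; rewrite /=; lia.
- apply: final_pair_grass => //; first exact: (hstrip_rsk_rule e stm stn).2.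
  by apply: add_strip_rows => // k; have [/(_ k)[]] := hstrip_rsk_rule e stm stn.
by exists (weak nu (add_boxes mu new)), (strong mu new).
Qed.

End LocalRule.

(** * Row insertion of a word *)

Local Open Scope nat_scope.

Section RowInsertion.
Implicit Types (r u s t : seq nat) (T : seq (seq nat)) (x y j k : nat).

(** [row_insert] is split into its action on one row and the letter, if any, that
    this row passes on, so that whole words can be inserted row by row. *)
Definition rowins r x :=
  let k := find (fun y => x < y) r in
  if k < size r then set_nth 0 r k x else rcons r x.

Definition bumped r x : seq nat :=
  let k := find (fun y => x < y) r in
  if k < size r then [:: nth 0 r k] else [::].

Definition ins_word T u := foldl (fun T x => (row_insert x T).1) T u.
Definition row_word r u := foldl rowins r u.
Fixpoint bump_word r u :=
  if u is x :: u' then bumped r x ++ bump_word (rowins r x) u' else [::].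

Lemma ins_word_head T u : head [::] (ins_word T u) = row_word (head [::] T) u.
Proof.
elim: u T => //= x u IH T; rewrite IH; congr row_word.
case: T => [|r T] //=; rewrite /rowins.
by case: ifP => // _; case: (row_insert _ T).
Qed.

Lemma ins_word_behead T u :
  behead (ins_word T u) = ins_word (behead T) (bump_word (head [::] T) u).
Proof.
elim: u T => //= x u IH T; rewrite IH {IH} /ins_word foldl_cat.
case: T => [|r T] //=; rewrite /rowins /bumped.
by case: ifP => // _ /=; case: (row_insert _ T).
Qed.

(** The word that reaches row [k] when [u] is inserted in [T]. *)
Fixpoint letters T u k :=
  if k is k'.+1 then bump_word (nth [::] T k') (letters T u k') else u.

Lemma letters_behead T u k :
  letters T u k.+1 = letters (behead T) (bump_word (head [::] T) u) k.
Proof.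
elim: k => [|k IH]; first by rewrite /= nth0.
by rewrite [LHS]/= -/(letters T u k.+1) IH /= nth_behead.
Qed.

Lemma nth_ins_word T u k :
  nth [::] (ins_word T u) k = row_word (nth [::] T k) (letters T u k).
Proof.
elim: k T u => [|k IH] T u; first by rewrite !nth0 ins_word_head.
by rewrite -nth_behead ins_word_behead IH nth_behead letters_behead.
Qed.

Lemma rowinsP r x : sorted leq r ->
  (rowins r x = rcons r x /\ bumped r x = [::] /\ all (geq x) r) \/
  (exists s y t, [/\ r = s ++ y :: t, rowins r x = s ++ x :: t, bumped r x = [:: y],
     all (geq x) s & x < y /\ all (leq y) t]).
Proof.
move=> so; rewrite /rowins /bumped; case: ltnP => lt; last first.
  left; split => //; split => //; apply/allP => y yr /=; rewrite leqNgt; apply/negP => xy.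
  by move: lt; rewrite leqNgt -has_find; case/negP; apply/hasP; exists y.
right; set k := find _ _ in lt *.
exists (take k r), (nth 0 r k), (drop k.+1 r).
have rE : r = take k r ++ nth 0 r k :: drop k.+1 r by rewrite -drop_nth // cat_take_drop.
split=> //.
- by rewrite set_nthE lt.
- apply/allP => y /(nthP 0)[i]; rewrite size_take lt => ik <-.
  by rewrite nth_take //= leqNgt; apply/negbT/(before_find 0 ik).
split; first by apply: (@nth_find _ 0 (fun y => x < y)); rewrite has_find.
move: so; rewrite sorted_pairwise; last exact: leq_trans.
by rewrite {1}rE pairwise_cat => /and3P[_ _ /andP[]].
Qed.

Lemma rowins_sorted r x : sorted leq r -> sorted leq (rowins r x).
Proof.
move=> so; have [[-> [_ le]]|[s [y [t [rE -> _ sx [xy ty]]]]]] := rowinsP x so.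
  case: r so le => //= a r so /andP[ax le]; rewrite rcons_path so /=.
  have := mem_last a r; rewrite inE => /predU1P[->//|lr].
  exact: (allP le _ lr).
move: so; rewrite !(sorted_pairwise leq_trans) rE !pairwise_cat /=.
move=> /and3P[rel ps /andP[_ pt]]; rewrite ps pt.
have xt : all (leq x) t by apply: sub_all ty => z; exact: leq_trans (ltnW xy).
rewrite xt !andbT; apply/allrelP => a b as_; rewrite inE => /predU1P[->|bt].
  exact: (allP sx _ as_).
exact: leq_trans (allP sx _ as_) (allP xt _ bt).
Qed.

Definition cnt j r := count (fun x => x <= j) r.

Lemma cnt_le j r : cnt j r <= cnt j.+1 r.
Proof. by apply: sub_count => x; exact: leqW. Qed.

Lemma cnt_all x j r : all (geq x) r -> x <= j -> cnt j r = size r.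
Proof.
by move=> le xj; apply/eqP; rewrite -all_count; apply: sub_all le => z /leq_trans; apply.
Qed.

Lemma cnt_none y j r : all (leq y) r -> j < y -> cnt j r = 0.
Proof.
move=> le jy; apply/eqP; rewrite -leqn0 leqNgt -has_count; apply/hasPn => z zr.
by have := allP le _ zr; rewrite /=; lia.
Qed.

Lemma bump_word_rcons r u x :
  bump_word r (rcons u x) = bump_word r u ++ bumped (row_word r u) x.
Proof. by elim: u r => [|y u IH] r /=; rewrite ?cats0 // IH catA. Qed.

Lemma row_word_rcons r u x : row_word r (rcons u x) = rowins (row_word r u) x.
Proof. by rewrite /row_word -cats1 foldl_cat. Qed.

Lemma sorted_leq_rconsP (s : seq nat) k : sorted leq (rcons s k) ->
  sorted leq s /\ forall y, y \in s -> y <= k.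
Proof.
rewrite !(sorted_pairwise leq_trans) -cats1 pairwise_cat => /and3P[/allrelP h -> _].
by split=> // y ys; apply: h; rewrite ?mem_head.
Qed.

(** By induction on the last letter of the word. The letters up to [j] end where
    either those up to [j - 1] end after insertion or the old letters [j] ended,
    followed by the inserted letters [j]; the old letters [j] that have been
    overwritten are the ones bumped. *)
Lemma row_word_cnt r u : sorted leq r -> sorted leq u ->
  [/\ sorted leq (row_word r u), sorted leq (bump_word r u),
      cnt 0 (row_word r u) = cnt 0 r + count_mem 0 u, count_mem 0 (bump_word r u) = 0
    & forall j, cnt j.+1 (row_word r u) =
        maxn (cnt j (row_word r u)) (cnt j.+1 r) + count_mem j.+1 u /\
      count_mem j.+1 (bump_word r u) =
        minn (cnt j (row_word r u)) (cnt j.+1 r) - cnt j r].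
Proof.
move=> sr; elim/last_ind: u => [|u x IH].
  move=> _; split=> //=; first by rewrite addn0.
  by move=> j; have := cnt_le j r; lia.
case/sorted_leq_rconsP => su ux; have {IH} [sr1 sb c0 b0 cb] := IH su.
rewrite bump_word_rcons row_word_rcons; set r1 := row_word r u in sr1 c0 cb *.
have u0 j : x < j -> count_mem j u = 0.
  by move=> xj; apply/count_memPn/negP => /ux; lia.
have uE j : count_mem j (rcons u x) = count_mem j u + (x == j).
  by rewrite -cats1 count_cat /= addn0.
have sr2 := rowins_sorted x sr1.
have [[r2E [bE le]]|[s [y [t [r1E r2E bE sx [xy ty]]]]]] := rowinsP x sr1.
  have cE j : cnt j (rowins r1 x) = cnt j r1 + (x <= j).
    by rewrite r2E /cnt -cats1 count_cat /= addn0.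
  have big j : x <= j -> cnt j r1 = size r1 by exact: cnt_all.
  rewrite bE cats0; split=> //; first by rewrite cE uE c0; lia.
  move=> j; rewrite !cE uE; have [] := cb j.
  by have := big j; have := big j.+1; have := u0 j.+1; case: (x =P j.+1) => [->|]; lia.
have cE j : cnt j (rowins r1 x) + (y <= j) = cnt j r1 + (x <= j).
  by rewrite r2E r1E /cnt !count_cat /=; lia.
have mid j : x <= j < y -> cnt j r1 = size s.
  move=> /andP[xj jy]; rewrite r1E /cnt count_cat /= -/(cnt j s) -/(cnt j t).
  by rewrite (cnt_all sx xj) (cnt_none ty jy); lia.
have at_y : size s < cnt y r1.
  rewrite r1E /cnt count_cat /= -/(cnt y s) -/(cnt y t) (cnt_all sx (ltnW xy)); lia.
have y0 : 0 < y by lia.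
(* Beyond the bumped letter the row still consists of its original entries. *)
have above j : y <= j -> cnt j r1 = cnt j r.
  move=> /subnKC<-; elim: (j - y) => [|d IH].
    rewrite addn0; have [+ _] := cb y.-1; rewrite prednK // u0 //.
    by have := mid y.-1; lia.
  rewrite addnS; have [+ _] := cb (y + d); rewrite IH u0; last by lia.
  by have := cnt_le (y + d) r; lia.
have lo j : cnt j r <= cnt j r1.
  by case: j => [|j]; [rewrite c0; lia | have [] := cb j; lia].
have bumpE j : count_mem j (bump_word r u ++ bumped r1 x) =
    count_mem j (bump_word r u) + (y == j).
  by rewrite count_cat bE /= addn0.
split=> //.
- rewrite bE cats1; apply: sorted_rcons_last => // z zb; rewrite leqNgt; apply/negP => yz.
  have : 0 < count_mem z (bump_word r u) by rewrite -has_count has_pred1.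
  case: z yz {zb} => // z yz; have [_ ->] := cb z.
  by have := above z; lia.
- by have := cE 0; rewrite uE c0; lia.
- by rewrite bumpE b0; lia.
move=> j; rewrite bumpE uE; have [cj bj] := cb j.
have := cE j; have := cE j.+1; have := mid j; have := mid j.+1; have := u0 j.+1.
have := above j; have := above j.+1; have := lo j.
case: (y =P j.+1) => [yE|]; last by case: (x =P j.+1); lia.
by subst y; case: (x =P j.+1); lia.
Qed.

End RowInsertion.

(** * The growth diagram of row insertion *)

Section RSKShapes.
Variable m : {fsfun nat * nat -> nat with 0}.
Hypothesis m_pos : matrix_pos m.
Implicit Types (i j k : nat) (T : seq (seq nat)).

(** The shape in position (i, j) of the growth diagram of row insertion. *)
Fixpoint rsk_shape i : nat -> nat -> nat :=
  if i is i'.+1 then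
    fix row j := if j is j'.+1 then
      rsk_rule (rsk_shape i' j') (row j') (rsk_shape i' j'.+1) (m (i'.+1, j'.+1))
    else fun _ => 0
  else fun _ _ => 0.

Lemma rsk_shapeSS i j : rsk_shape i.+1 j.+1 =
  rsk_rule (rsk_shape i j) (rsk_shape i.+1 j) (rsk_shape i j.+1) (m (i.+1, j.+1)).
Proof. by []. Qed.

Lemma rsk_shape0r i : rsk_shape i 0 = fun _ => 0.
Proof. by case: i. Qed.

Lemma hstrip_rsk_shape i j :
  hstrip (rsk_shape i j) (rsk_shape i.+1 j) /\ hstrip (rsk_shape i j) (rsk_shape i j.+1).
Proof.
have down i' : (forall j', hstrip (rsk_shape i' j') (rsk_shape i' j'.+1)) ->
    forall j', hstrip (rsk_shape i' j') (rsk_shape i'.+1 j').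
  move=> right; elim=> [|j' IH]; first by rewrite !rsk_shape0r.
  by have [] := hstrip_rsk_rule (m (i'.+1, j'.+1)) IH (right j').
have right i' : forall j', hstrip (rsk_shape i' j') (rsk_shape i' j'.+1).
  elim: i' => [|i' IH] j' //.
  by have [] := hstrip_rsk_rule (m (i'.+1, j'.+1)) (down i' IH j') (IH j').
by split; [apply: down|].
Qed.

Lemma rsk_shape_dec i j k : rsk_shape i j k.+1 <= rsk_shape i j k.
Proof.
have [st _] := hstrip_rsk_shape i j.
case: i st => // i _; case: j => [|j]; first by rewrite rsk_shape0r.
have [_ st] := hstrip_rsk_shape i.+1 j; have := st k; lia.
Qed.

Lemma rsk_shape_rows i j k : i <= k -> rsk_shape i j k = 0.
Proof.
elim: i j k => // i IHi j k; elim: j k => // j IHj [//|k] ik.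
rewrite rsk_shapeSS /rsk_rule IHj // !IHi //; last by lia.
Qed.

(** A zero row leaves the shapes unchanged, which makes the diagram constant far
    away; the same holds for columns. *)
Lemma rsk_shape_row_stable i : (forall j, m (i.+1, j) = 0) ->
  forall j, rsk_shape i.+1 j = rsk_shape i j.
Proof.
move=> m0; elim=> [|j IH]; first by rewrite !rsk_shape0r.
apply: functional_extensionality => k; rewrite rsk_shapeSS IH /rsk_rule m0.
have [_ st] := hstrip_rsk_shape i j; have := st k.
case: k => [|k]; first by lia.
by have := st k; lia.
Qed.

Lemma rsk_shape_col_stable j : (forall i, m (i, j.+1) = 0) ->
  forall i, rsk_shape i j.+1 = rsk_shape i j.
Proof.
move=> m0; elim=> [//|i IH].
apply: functional_extensionality => k; rewrite rsk_shapeSS IH /rsk_rule m0.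
have [st _] := hstrip_rsk_shape i j; have := st k.
case: k => [|k]; first by lia.
by have := st k; lia.
Qed.

Lemma rsk_shape_mono i i' j j' k : i <= i' -> j <= j' ->
  rsk_shape i j k <= rsk_shape i' j' k.
Proof.
move=> /subnKC<- /subnKC<-.
apply: (@leq_trans (rsk_shape (i + (i' - i)) j k)).
  elim: (i' - i) => [|d IH]; first by rewrite addn0.
  by rewrite addnS; apply: leq_trans IH _; have [/(_ k)[]] := hstrip_rsk_shape (i + d) j.
elim: (j' - j) => [|d IH]; first by rewrite addn0.
by rewrite addnS; apply: leq_trans IH _; have [_ /(_ k)[]] := hstrip_rsk_shape (i + (i' - i)) (j + d).
Qed.

Variables (M C : nat).
Hypothesis m_supp : forall p, p \in finsupp m -> p.1 <= M /\ p.2 <= C.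

Lemma m_out i j : (M < i) || (C < j) -> m (i, j) = 0.
Proof.
move=> out; apply/eqP; apply: contraT; rewrite -mem_finsupp => /m_supp /=; lia.
Qed.

Lemma rsk_shape_stable_row i j : M <= i -> rsk_shape i j = rsk_shape M j.
Proof.
move=> /subnKC<-; elim: (i - M) => [|d IH]; first by rewrite addn0.
by rewrite addnS rsk_shape_row_stable // => j'; apply: m_out; lia.
Qed.

Lemma rsk_shape_stable_col i j : C <= j -> rsk_shape i j = rsk_shape i C.
Proof.
move=> /subnKC<-; elim: (j - C) => [|d IH]; first by rewrite addn0.
by rewrite addnS rsk_shape_col_stable // => i'; apply: m_out; lia.
Qed.

Lemma rsk_shape_le i j k : rsk_shape i j k <= rsk_shape M C 0.
Proof.
apply: (@leq_trans (rsk_shape i j 0)).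
  by elim: k => // k; apply: leq_trans; exact: rsk_shape_dec.
apply: (@leq_trans (rsk_shape (maxn i M) (maxn j C) 0)).
  by apply: rsk_shape_mono; exact: leq_maxl.
by rewrite rsk_shape_stable_row ?leq_maxr // rsk_shape_stable_col ?leq_maxr.
Qed.

Lemma rsk_shape_rows_le i j k : M <= k -> rsk_shape i j k = 0.
Proof.
move=> Mk; have := rsk_shape_mono k (leq_maxl i M) (leqnn j).
by rewrite (rsk_shape_stable_row _ (leq_maxr i M)) (rsk_shape_rows j Mk); lia.
Qed.

Definition row_letters i := flatten [seq nseq (m (i, j)) j | j <- iota 1 C].

Lemma count_row_letters i j : count_mem j (row_letters i) = m (i, j).
Proof.
rewrite (count_flatten_nseq (fun j => m (i, j))) ?iota_uniq // mem_iota.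
case: ifP => // out; case: j out => [|j] out; first by rewrite m_pos ?orbT.
by rewrite m_out //; lia.
Qed.

Lemma row_letters_sorted i : sorted leq (row_letters i).
Proof.
rewrite /row_letters; have : pairwise ltn (iota 1 C).
  by rewrite -(sorted_pairwise ltn_trans) iota_ltn_sorted.
rewrite (sorted_pairwise leq_trans); elim: (iota 1 C) => //= j s IH /andP[js /IH ps].
rewrite pairwise_cat ps andbT; apply/andP; split; last first.
  by elim: (m (i, j)) => //= e ->; rewrite andbT all_nseq leqnn orbT.
apply/allrelP => a b; rewrite mem_nseq => /andP[_ /eqP->] /flatten_mapP[c cs].
by rewrite mem_nseq => /andP[_ /eqP->]; apply: ltnW; exact: (allP js).
Qed.

Fixpoint ins_tableau i :=
  if i is i'.+1 then ins_word (ins_tableau i') (row_letters i) else [::].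

(** Inside row [k] the recursion on [j] is the one of [row_word_cnt], and the
    bumped letters are the last summand of [rsk_rule] for row [k + 1]. *)
Lemma ins_word_rsk i T : (forall k, sorted leq (nth [::] T k)) ->
  (forall k j, cnt j (nth [::] T k) = rsk_shape i j k) ->
  (forall k, sorted leq (nth [::] (ins_word T (row_letters i.+1)) k)) /\
  (forall k j, cnt j (nth [::] (ins_word T (row_letters i.+1)) k) = rsk_shape i.+1 j k).
Proof.
move=> sT cT; set u := row_letters i.+1.
pose new j k := if k is k'.+1
  then minn (rsk_shape i.+1 j k') (rsk_shape i j.+1 k') - rsk_shape i j k'
  else m (i.+1, j.+1).
have main k : [/\ sorted leq (letters T u k), count_mem 0 (letters T u k) = 0,
    forall j, count_mem j.+1 (letters T u k) = new j k,
    sorted leq (nth [::] (ins_word T u) k)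
  & forall j, cnt j (nth [::] (ins_word T u) k) = rsk_shape i.+1 j k].
  have cnt_rec k' : sorted leq (letters T u k') -> count_mem 0 (letters T u k') = 0 ->
      (forall j, count_mem j.+1 (letters T u k') = new j k') ->
      sorted leq (nth [::] (ins_word T u) k') /\
      forall j, cnt j (nth [::] (ins_word T u) k') = rsk_shape i.+1 j k'.
    move=> su c0 cu; rewrite nth_ins_word; have [sr _ r0 _ cr] := row_word_cnt (sT k') su.
    split=> //; elim=> [|j IH]; first by rewrite r0 c0 cT !rsk_shape0r.
    by have [-> _] := cr j; rewrite IH cu cT rsk_shapeSS /rsk_rule /new; case: k' {sr r0 cr su c0 cu IH}.
  elim: k => [|k [su c0 cu sr cr]].
    have su : sorted leq (letters T u 0) by exact: row_letters_sorted.
    have c0 : count_mem 0 (letters T u 0) = 0 by rewrite count_row_letters m_pos ?orbT.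
    have cu j : count_mem j.+1 (letters T u 0) = new j 0 by rewrite count_row_letters.
    by have [] := cnt_rec 0 su c0 cu.
  have [_ sb _ b0 cb] := row_word_cnt (sT k) su.
  have cu' j : count_mem j.+1 (letters T u k.+1) = new j k.+1.
    by rewrite /=; have [_ ->] := cb j; rewrite -nth_ins_word cr !cT.
  by have [] := cnt_rec k.+1 sb b0 cu'.
by split=> k; have [] := main k.
Qed.

Lemma ins_tableau_rsk i : (forall k, sorted leq (nth [::] (ins_tableau i) k)) /\
  (forall k j, cnt j (nth [::] (ins_tableau i) k) = rsk_shape i j k).
Proof.
elim: i => [|i [sT cT]]; first by split=> k; rewrite nth_nil.
exact: ins_word_rsk.
Qed.

(** All entries are at most some bound, beyond which the shapes do not depend on
    the column index. *)
Lemma size_ins_tableau i k : size (nth [::] (ins_tableau i) k) = rsk_shape i C k.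
Proof.
have [_ cT] := ins_tableau_rsk i.
set r := nth _ _ _ in cT *.
pose b := \max_(x <- nth [::] (ins_tableau i) k) x.
rewrite -(rsk_shape_stable_col i (leq_maxl C b)) -cT.
rewrite (@cnt_all b) ?leq_maxr //; apply/allP => x xr.
by rewrite /b /=; apply: (@leq_bigmax_seq _ _ xpredT id).
Qed.

End RSKShapes.

(** * The biword and the recording tableau *)

Lemma lex_le_trans : transitive lex_le.
Proof. by move=> [a b] [c d] [e f]; rewrite /lex_le /=; lia. Qed.

Lemma lex_le_anti : antisymmetric lex_le.
Proof.
move=> [a b] [c d]; rewrite /lex_le /= => h.
by have -> : a = c; [lia | have -> : b = d; [lia |]].
Qed.

Lemma lex_le_total : total lex_le.
Proof. by move=> [a b] [c d]; rewrite /lex_le /=; lia. Qed.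

Lemma allpairs_sorted s t : sorted ltn s -> sorted ltn t ->
  sorted lex_le [seq (i, j) | i <- s, j <- t].
Proof.
rewrite (sorted_pairwise lex_le_trans) !(sorted_pairwise ltn_trans) => ps pt.
elim: s ps => //= i s IH /andP[is_ /IH ps].
rewrite pairwise_cat ps andbT; apply/andP; split.
  apply/allrelP => _ _ /mapP[j _ ->] /allpairsP[[i' j'] [i's _ ->]].
  by rewrite /lex_le /= (allP is_ _ i's).
rewrite pairwise_map; apply: sub_pairwise pt => a b ab.
by rewrite /lex_le /= eqxx (ltnW ab) orbT.
Qed.

Section Recording.
Implicit Types (T P Q : seq (seq nat)) (w : seq (nat * nat)).

Lemma size_row_insert x T k :
  size (nth [::] (row_insert x T).1 k) = size (nth [::] T k) + (k == (row_insert x T).2).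
Proof.
elim: T x k => [|r T IH] x k; first by case: k => [|k] //=; rewrite nth_nil.
rewrite /=; case: ifP => lt; last first.
  by case: k => [|k] /=; rewrite ?size_rcons ?addn1 ?addn0.
have := IH (nth 0 r (find (fun y => x < y) r)); case: (row_insert _ T) => T' d /= IHd.
case: k => [|k] /=; last by rewrite IHd eqSS.
by rewrite size_set_nth (maxn_idPr lt) addn0.
Qed.

Lemma nth_record_box i d T k :
  nth [::] (record_box i d T) k = if k == d then rcons (nth [::] T d) i else nth [::] T k.
Proof. by rewrite /record_box nth_set_nth /=; case: eqP. Qed.

Lemma RSK_stepE P Q p : RSK_step (P, Q) p =
  ((row_insert p.2 P).1, record_box p.1 (row_insert p.2 P).2 Q).
Proof. by rewrite /RSK_step; case: (row_insert p.2 P). Qed.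

Lemma RSK_fst w P Q :
  (foldl RSK_step (P, Q) w).1 = ins_word P [seq p.2 | p <- w].
Proof.
by elim: w P Q => //= p w IH P Q; rewrite RSK_stepE IH.
Qed.

(** Both tableaux grow in the same row, and the recorded entry is at most [i];
    stated with sums in order to avoid subtraction. *)
Lemma RSK_snd_le w P Q i k : all (fun p => p.1 <= i) w ->
  cnt i (nth [::] (foldl RSK_step (P, Q) w).2 k) + size (nth [::] P k) =
  cnt i (nth [::] Q k) + size (nth [::] (foldl RSK_step (P, Q) w).1 k).
Proof.
elim: w P Q => //= p w IH P Q /andP[pi wi]; rewrite RSK_stepE.
have := IH (row_insert p.2 P).1 (record_box p.1 (row_insert p.2 P).2 Q) wi.
rewrite nth_record_box size_row_insert.
by case: (k =P _) => [->|_]; rewrite /cnt -?cats1 ?count_cat /=; lia.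
Qed.

Lemma RSK_snd_gt w P Q i k : all (fun p => i < p.1) w ->
  cnt i (nth [::] (foldl RSK_step (P, Q) w).2 k) = cnt i (nth [::] Q k).
Proof.
elim: w P Q => //= p w IH P Q /andP[pi wi]; rewrite RSK_stepE IH // nth_record_box.
by case: eqP => [->|_] //; rewrite /cnt -?cats1 ?count_cat /= leqNgt pi !addn0.
Qed.

End Recording.

Section RSKChains.
Variable m : {fsfun nat * nat -> nat with 0}.
Hypothesis m_pos : matrix_pos m.
Variables (M C : nat).
Hypothesis m_supp : forall p, p \in finsupp m -> p.1 <= M /\ p.2 <= C.

Lemma flatten_nseq_supp (s : seq (nat * nat)) :
  flatten [seq nseq (m p) p | p <- s & p \in finsupp m] = flatten [seq nseq (m p) p | p <- s].
Proof.
elim: s => //= p s IH; case: ifP => /= [_|/negbT]; first by rewrite IH.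
by rewrite memNfinsupp IH => /eqP->.
Qed.

Definition row_block i := [seq (i, j) | j <- row_letters m C i].

(** Pairs outside the support contribute nothing, so the lexicographic order can
    be read on a full rectangle. *)
Lemma biword_blocks : biword m = flatten [seq row_block i | i <- iota 1 M].
Proof.
have -> : biword m =
    flatten [seq nseq (m p) p | p <- [seq (i, j) | i <- iota 1 M, j <- iota 1 C]].
  rewrite -flatten_nseq_supp /biword; congr (flatten (map _ _)).
  apply: (sorted_eq lex_le_trans lex_le_anti).
  - exact/sort_sorted/lex_le_total.
  - apply: (sorted_filter lex_le_trans).
    by apply: allpairs_sorted; exact: iota_ltn_sorted.
  apply: uniq_perm; rewrite ?sort_uniq ?fset_uniq //.
    apply/filter_uniq/allpairs_uniq; rewrite ?iota_uniq //.
    by move=> [a b] [c d].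
  move=> [i j]; rewrite mem_sort mem_filter; case: (boolP (_ \in _)) => //= ij.
  apply/esym/allpairsP; exists (i, j); have /= [iM jC] := m_supp ij.
  move: ij; rewrite mem_finsupp => mij.
  have i0 : i != 0 by apply: contra_neq mij => ->; rewrite m_pos.
  have j0 : j != 0 by apply: contra_neq mij => ->; rewrite m_pos ?orbT.
  by rewrite !mem_iota /=; split => //; lia.
elim: (iota 1 M) => //= i s <-; rewrite map_cat flatten_cat; congr (_ ++ _).
by rewrite /row_block /row_letters map_flatten -!map_comp; congr flatten;
  apply: eq_map => j /=; rewrite map_nseq.
Qed.

Lemma ins_tableau_blocks i :
  ins_word [::] [seq p.2 | p <- flatten [seq row_block i | i <- iota 1 i]] = ins_tableau m C i.
Proof.
elim: i => // i IH; rewrite -(addn1 i) iotaD !map_cat flatten_cat map_cat.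
rewrite /ins_word foldl_cat -/(ins_word [::] _) IH /= cats0 addn1 add1n.
by rewrite /row_block -map_comp map_id.
Qed.

Lemma RSK_ins_tableau : (RSK m).1 = ins_tableau m C M.
Proof. by rewrite /RSK RSK_fst biword_blocks ins_tableau_blocks. Qed.

(** The pairs with first entry at most [i] form a prefix of the biword, and the
    pairs after it only add larger entries to the recording tableau. *)
Lemma RSK_rec_tableau i k : cnt i (nth [::] (RSK m).2 k) = rsk_shape m i C k.
Proof.
rewrite /RSK biword_blocks.
wlog iM : i / i <= M.
  move=> hw; case: (leqP i M) => iM; first exact: hw.
  rewrite (rsk_shape_stable_row m_supp _ (ltnW iM)) -(hw M) //.
  set w := flatten _.
  have wM : all (fun p => p.1 <= M) w.
    by apply/allP => p /flatten_mapP[j]; rewrite mem_iota => jM /mapP[x _ ->] /=; lia.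
  have wi : all (fun p => p.1 <= i) w by apply: sub_all wM => p; lia.
  have := RSK_snd_le [::] [::] k wM; have := RSK_snd_le [::] [::] k wi.
  by rewrite /= !nth_nil /=; lia.
rewrite -(subnKC iM) iotaD map_cat flatten_cat foldl_cat add1n.
case E : (foldl _ _ (flatten [seq row_block i | i <- iota 1 i])) => [P Q]; rewrite RSK_snd_gt; last first.
  by apply/allP => p /flatten_mapP[j]; rewrite mem_iota => jM /mapP[x _ ->] /=; lia.
have wi : all (fun p => p.1 <= i) (flatten [seq row_block i | i <- iota 1 i]).
  by apply/allP => p /flatten_mapP[j]; rewrite mem_iota => jM /mapP[x _ ->] /=; lia.
have := RSK_snd_le [::] [::] k wi; rewrite RSK_fst ins_tableau_blocks.
rewrite (size_ins_tableau m_pos m_supp) E /= !nth_nil /=; lia.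
Qed.

Lemma tableau_chain_shape B T j la : boxed B la ->
  (forall k, cnt j (nth [::] T k) = la k) -> tableau_chain T j = shape B la.
Proof.
move=> bx cE; rewrite /tableau_chain /shape.
have -> : [seq count (fun x => x <= j) r | r <- T] = mkseq la (size T).
  apply: (@eq_from_nth _ 0); first by rewrite size_map size_mkseq.
  move=> k; rewrite size_map => kT.
  by rewrite (nth_map [::]) // nth_mkseq // -cE.
have tail k : minn B (size T) <= k -> la k = 0.
  rewrite geq_min => /orP[Bk|Tk]; first exact: boxed_eq0 bx Bk.
  by rewrite -cE nth_default.
by rewrite !(filter_mkseq tail) // ?geq_minl ?geq_minr.
Qed.

End RSKChains.

(** * Uniqueness of affine insertion *)

Local Open Scope ring_scope.

Section Determinism.
Variables (n : nat) (l : int).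
Implicit Types (W : weak_strip n) (S : strong_strip) (C : strong_cover).

Lemma max_consecutive_unique T R q p q' p' :
  max_consecutive T R q p -> max_consecutive T R q' p' -> q = q' /\ p = p'.
Proof.
move=> [c Rq mx] [c' Rq' mx'].
have qE : q = q' by apply/eqP; rewrite eq_le (mx' _ _ c Rq) (mx _ _ c' Rq').
subst q'; split=> //; case: c c' => [_ Tp qp no] [_ Tp' qp' no'].
case: (ltgtP p p') => // lt.
  by have := no' p; rewrite qp lt Tp => /(_ isT).
by have := no p'; rewrite qp' lt Tp' => /(_ isT).
Qed.

Lemma cover_chain_rcons w cs C : is_cover_chain n l w (rcons cs C) ->
  is_cover_chain n l w cs /\ is_strong_cover n l C.
Proof.
by elim: cs w => /= [w [] //|C' cs IH w [sc insE /IH[]]]; split.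
Qed.

Lemma affine_perm_inj w : affine_perm n w -> injective w.
Proof. by case=> /bij_inj. Qed.

(** The cases exclude each other, the pair (q, p) is the one with maximal [q],
    and positions are determined by values since the maps are injective. In
    the third case the intermediate permutation is determined by being the
    target of a cover. *)
Lemma internal_insertion_functional C W S W1 S1 W2 S2 :
  internal_insertion l C W S W1 S1 -> internal_insertion l C W S W2 S2 ->
  W1 = W2 /\ S1 = S2.
Proof.
move=> [[scC _] [_ [_ chS _] _] r1 [_ [_ ch1 _] _]] [_ _ r2 [_ [_ ch2 _] _]].
have uinj : injective (sc_out C) by case: scC => -[_ /affine_perm_inj].
case: W1 S1 / r1 ch1 => [i j u A v x vij _|q p a b i j u v p0 A A' x vji ni mx ua ub _
    |cs C1 q p a b v' i j u v p0 A A' x y vji csE C1i mx ya yb ch1].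
- case: W2 S2 / r2 ch2 => [//|q p a b ? ? ? ? ? ? ? ? vji|cs C1 q p a b v' ? ? ? ? ? ? ? ? ? vji];
    by have := lt_trans vij vji; rewrite ltxx.
- case: W2 S2 / r2 ch2 => [? ? ? ? ? ? vij|q' p' a' b' ? ? ? ? ? ? ? ? _ _ mx' ua' ub' _
    |cs C1 q' p' a' b' v' ? ? ? ? ? ? ? ? ? _ csE C1i].
  + by have := lt_trans vij vji; rewrite ltxx.
  + have [qE pE] := max_consecutive_unique mx mx'.
    have aE : a = a' by apply: uinj; rewrite -/u ua qE -ua'.
    have bE : b = b' by apply: uinj; rewrite -/u ub pE -ub'.
    by clear mx' ua' ub'; subst a' b' q' p'.
  by case: (ni _ _ csE).
case: W2 S2 / r2 ch2 => [? ? ? ? ? ? vij|q' p' a' b' ? ? ? ? ? ? ? ? _ ni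
  |cs2 C2 q' p' a' b' v2 ? ? ? ? ? ? ? ? ? _ csE2 C2i mx' ya' yb' ch2].
- by have := lt_trans vij vji; rewrite ltxx.
- by case: (ni _ _ csE).
have /rcons_inj[csE' C1E] : rcons cs C1 = rcons cs2 C2 by rewrite -csE -csE2.
subst cs2 C2; rewrite csE in chS; have [_ scC1] := cover_chain_rcons chS.
have yinj : injective y by case: scC1 => -[/affine_perm_inj].
have [qE pE] := max_consecutive_unique mx mx'.
have aE : a = a' by apply: yinj; rewrite ya qE -ya'.
have bE : b = b' by apply: yinj; rewrite yb pE -yb'.
clear mx' ya' yb'; subst a' b' q' p'.
have vE : v' = v2.
  have [/= /cover_chain_rcons[_ [_ _ _ /= -> _]] _] := cover_chain_rcons ch1.
  by have [/= /cover_chain_rcons[_ [_ _ _ /= -> _]] _] := cover_chain_rcons ch2.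
by subst v2.
Qed.

Lemma external_insertion_functional W S W1 S1 W2 S2 :
  external_insertion l W S W1 S1 -> external_insertion l W S W2 S2 ->
  W1 = W2 /\ S1 = S2.
Proof.
move=> [[[[_ aff] _ _ _] _ _] _ [q [p [a [b [mx va vb -> ->]]]]] _].
move=> [_ _ [q' [p' [a' [b' [mx' va' vb' -> ->]]]]] _].
have vinj := affine_perm_inj aff.
have [qE pE] := max_consecutive_unique mx mx'.
have -> : a = a' by apply: vinj; rewrite va qE -va'.
have -> : b = b' by apply: vinj; rewrite vb pE -vb'.
by rewrite qE.
Qed.

Lemma local_rule_functional W S e W1 S1 W2 S2 :
  local_rule l W S e W1 S1 -> local_rule l W S e W2 S2 -> W1 = W2 /\ S1 = S2.
Proof.
case=> _ _ _ [V1 [R1 [int1 ext1]]] [_ _ _ [V2 [R2 [int2 ext2]]]].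
have [VE RE] : V1 = V2 /\ R1 = R2.
  move: (StrongStrip _ [::]) int1 int2 => S0; move: W S0.
  elim: (ss_covers S) {ext1 ext2} => [|C cs IH] W0 S0 /=.
    by move=> [-> ->] [-> ->].
  move=> [Wa [Sa [ia ia']]] [Wb [Sb [ib ib']]].
  have [WE SE] := internal_insertion_functional ia ib; subst Wb Sb.
  exact: IH ia' ib'.
subst V2 R2; move: V1 R1 ext1 ext2 {int1 int2}.
elim: e => [|e IH] V R /=; first by move=> [-> ->] [-> ->].
move=> [Wa [Sa [ia ia']]] [Wb [Sb [ib ib']]].
have [WE SE] := external_insertion_functional ia ib; subst Wb Sb.
exact: IH ia' ib'.
Qed.

(** Each local rule determines the right and lower edges of a square from the
    left and upper ones. *)
Lemma growth_diagram_unique m G H V G' H' V' :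
  is_growth_diagram (n := n) l m G H V -> is_growth_diagram l m G' H' V' ->
  forall i j, H i j = H' i j /\ V i j = V' i j.
Proof.
move=> [_ b _ _ loc] [_ b' _ _ loc'].
have rowV i : (forall j, H i j = H' i j) -> forall j, V i j = V' i j.
  move=> HE; elim=> [|j VE]; first by rewrite (b i).2 (b' i).2.
  have := loc' i j; rewrite -HE -VE => lr'.
  by have [] := local_rule_functional (loc i j) lr'.
have rowH i : forall j, H i j = H' i j.
  elim: i => [|i HE] j; first by rewrite (b j).1 (b' j).1.
  have := loc' i j; rewrite -HE -(rowV i HE) => lr'.
  by have [] := local_rule_functional (loc i j) lr'.
by move=> i j; split; [exact: rowH | exact/rowV/rowH].
Qed.

Lemma affine_insertion_unique m PQ PQ' :
  affine_insertion l m PQ -> affine_insertion l m PQ' -> PQ = PQ' :> _ * (nat -> weak_strip n).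
Proof.
case: PQ PQ' => P Q [P' Q'] [_ _ [G [H [V [gd [K KE] [J JE]]]]]].
move=> [_ _ [G' [H' [V' [gd' [K' KE'] [J' JE']]]]]].
have HV := growth_diagram_unique gd gd'.
congr pair; apply: functional_extensionality => k.
  have := KE (maxn K K') (leq_maxl _ _) k; have := KE' (maxn K K') (leq_maxr _ _) k.
  by rewrite /= (HV _ _).1 => -> ->.
have := JE (maxn J J') (leq_maxl _ _) k; have := JE' (maxn J J') (leq_maxr _ _) k.
by rewrite /= (HV _ _).2 => -> ->.
Qed.

End Determinism.

(** * The growth diagram for large n *)

Section StableDiagram.
Variables (m : {fsfun nat * nat -> nat with 0%N}) (M C : nat).
Hypothesis m_pos : matrix_pos m.
Hypothesis m_supp : forall p, p \in finsupp m -> (p.1 <= M)%N /\ (p.2 <= C)%N.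
(* The box contains all shapes of the diagram and keeps two rows free, so that a
   cell bumped out of the lowest row has room. *)
Let B := maxn (rsk_shape m M C 0) M.+2.
Variable n : nat.
Hypothesis n_big : (B * B + 2 * B + 3 <= n)%N.
Let n_big' : (2 * B + 3 <= n)%N. Proof. by lia. Qed.

Local Notation L := (rsk_shape m).

Lemma boxed_rsk_shape i j : boxed B (L i j).
Proof.
split; first by move=> k; exact: rsk_shape_dec.
  by apply: leq_trans (rsk_shape_le m_supp i j 0) _; exact: leq_maxl.
by apply: (rsk_shape_rows_le m_supp); rewrite /B; lia.
Qed.

Definition diagram_strong i j := strong B n (L i j) (strip_rows B (L i j) (L i j.+1)).
Definition diagram_weak i j := weak B n (L i j) (L i.+1 j).

Lemma diagram_local i j :
  local_rule 0 (diagram_weak i j) (diagram_strong i j) (m (i.+1, j.+1))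
    (diagram_weak i j.+1) (diagram_strong i.+1 j).
Proof.
have [st st'] := hstrip_rsk_shape m i j.
have bxr := boxed_rsk_shape i.+1 j.+1.
apply: (local_rule_rsk n_big) => //; try exact: boxed_rsk_shape.
by apply: (rsk_shape_rows_le m_supp); rewrite /B; lia.
Qed.

Lemma ss_out_diagram i j : ss_out (diagram_strong i j) = affine_grass B n (L i j.+1).
Proof.
have [_ st] := hstrip_rsk_shape m i j.
rewrite ss_out_strong add_strip_rows //; first exact: boxed_rsk_shape.
by move=> k; exact: (st k).1.
Qed.

Lemma strip_rows_id la : boxed B la -> strip_rows B la la = [::].
Proof. by move=> bx; apply/esym; apply: strip_rows_unique. Qed.

Lemma strip_set_id la : strip_set B n la la = set0.
Proof.
apply/setP => x; rewrite !inE; apply/existsP => -[k /existsP[c]].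
by case/andP => /andP[h1 h2] _; lia.
Qed.

Lemma diagram_strong_trivial i j : L i j.+1 = L i j ->
  diagram_strong i j = StrongStrip (affine_grass B n (L i j)) [::].
Proof. by move=> E; rewrite /diagram_strong E strip_rows_id //; exact: boxed_rsk_shape. Qed.

Lemma is_growth_diagram_rsk : is_growth_diagram 0 m
  (fun i j => affine_grass B n (L i j)) diagram_strong diagram_weak.
Proof.
have G0 := affine_grass0 n_big'.
split=> [k|k|i j|i j|i j]; rewrite ?rsk_shape0r //; last exact: diagram_local.
  by rewrite diagram_strong_trivial // /diagram_weak !rsk_shape0r /weak strip_set_id G0.
by rewrite ss_out_diagram.
Qed.

Lemma affine_insertion_rsk :
  affine_insertion 0 m (fun j => diagram_strong M j, fun i => diagram_weak i C).
Proof.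
split=> /=.
- split=> [k|k|]; first by have [[_ st _] _ _ _] := diagram_local M k.
    by rewrite ss_out_diagram.
  exists C => k Ck; rewrite diagram_strong_trivial //.
  by rewrite (rsk_shape_stable_col m_supp _ (leqW Ck)) (rsk_shape_stable_col m_supp _ Ck).
- split=> [k|//|]; first by have [[wk _ _] _ _ _] := diagram_local k C.
  exists M => k Mk; rewrite /diagram_weak (rsk_shape_stable_row m_supp _ (leqW Mk)).
  by rewrite (rsk_shape_stable_row m_supp _ Mk) /= strip_set_id cards0.
exists (fun i j => affine_grass B n (L i j)), diagram_strong, diagram_weak.
split; first exact: is_growth_diagram_rsk.
  exists M => i Mi j; rewrite /diagram_strong.
  by rewrite !(rsk_shape_stable_row m_supp _ Mi).
exists C => j Cj i; rewrite /diagram_weak.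
by rewrite !(rsk_shape_stable_col m_supp _ Cj).
Qed.

Lemma core_chain_ins : core_chain n (fun k => ss_out (diagram_strong M k)) (tableau_chain (RSK m).1).
Proof.
have chainE k : tableau_chain (RSK m).1 k = shape B (L M k).
  apply: tableau_chain_shape; first exact: boxed_rsk_shape.
  rewrite (RSK_ins_tableau m_pos m_supp) => r.
  by have [_ ->] := ins_tableau_rsk m_pos m_supp M.
split=> [|k]; rewrite chainE; first by rewrite rsk_shape0r shape0.
by rewrite ss_out_diagram; apply: core_of_grass => //; exact: boxed_rsk_shape.
Qed.

Lemma core_chain_rec : core_chain n (fun k => ws_out (diagram_weak k C)) (tableau_chain (RSK m).2).
Proof.
have chainE k : tableau_chain (RSK m).2 k = shape B (L k C).
  apply: tableau_chain_shape; first exact: boxed_rsk_shape.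
  by move=> r; rewrite (RSK_rec_tableau m_pos m_supp).
split=> [|k]; rewrite chainE; first by rewrite shape0.
by apply: core_of_grass => //; exact: boxed_rsk_shape.
Qed.

End StableDiagram.

Theorem theorem10p4 (m : {fsfun nat * nat -> nat with 0%N})
    (hm : matrix_pos m) :
  exists N : nat, forall n : nat, (2 <= n)%N -> (N <= n)%N ->
    n_bounded n m /\
    exists PQ : (nat -> strong_strip) * (nat -> weak_strip n),
      [/\ unique (affine_insertion 0%R m) PQ,
          core_chain n (fun k => ss_out (PQ.1 k)) (tableau_chain (RSK m).1)
        & core_chain n (fun k => ws_out (PQ.2 k)) (tableau_chain (RSK m).2)].
Proof.
pose M := (\max_(p <- finsupp m) p.1)%N; pose C := (\max_(p <- finsupp m) p.2)%N.
have m_supp p : p \in finsupp m -> (p.1 <= M)%N /\ (p.2 <= C)%N.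
  by move=> pm; split; [apply: (@leq_bigmax_seq _ _ xpredT fst) | apply: (@leq_bigmax_seq _ _ xpredT snd)].
pose B := maxn (rsk_shape m M C 0) M.+2.
exists (B * B + 2 * B + 3 + \sum_(p <- finsupp m) m p)%N => n n2 nN.
have n_big : (B * B + 2 * B + 3 <= n)%N by lia.
split.
  move=> i; apply: (@leq_ltn_trans (\sum_(p <- finsupp m) m p)%N); last by lia.
  by rewrite [X in (_ <= X)%N](bigID (fun p => p.1 == i)) /= leq_addr.
exists (fun j => diagram_strong m M C n M j, fun i => diagram_weak m M C n i C).
have ins := affine_insertion_rsk m_supp n_big.
split.
- by split=> // PQ'; apply: affine_insertion_unique ins.
- exact: (core_chain_ins hm m_supp n_big).
exact: (core_chain_rec hm m_supp n_big).
Qed.
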